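(* For every integer $n\ge 2$, the set of $n$-centers of the standard Cauchy distribution is the closed interval $$\left[-\frac{\log (n-1)}{\pi},\ \frac{\log (n-1)}{\pi}\right].$$
   Context: The standard Cauchy distribution is the probability measure on $\mathbb{R}$ with density $f(x)=\frac{1}{\pi}\frac{1}{1+x^2}$ with respect to Lebesgue measure. For a probability measure $\mu$ on (the Borel $\sigma$-field of) $\mathbb{R}$ and a positive integer $n$, a real number $c$ is called an $n$-center of $\mu$ if there exist real random variables $X_1,\dots,X_n$ on a common probability space, each with distribution $\mu$, such that $X_1+\dots+X_n=nc$ almost surely. Equivalently, there is a probability measure $\lambda$ on $\mathbb{R}^n$ all of whose one-dimensional marginals equal $\mu$ and such that $\lambda(\{x\in\mathbb{R}^n: x_1+\dots+x_n=nc\})=1$. *)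

(* Defs.v *)
From HB Require Import structures.
From mathcomp Require Import all_boot all_order all_algebra.
From mathcomp Require Import all_classical all_reals all_analysis measurable_realfun.

Set Implicit Arguments.
Unset Strict Implicit.
Unset Printing Implicit Defensive.

Import Order.TTheory GRing.Theory Num.Theory.
Import numFieldNormedType.Exports.

Local Open Scope classical_set_scope.
Local Open Scope ring_scope.

Definition cauchy_pdf (R : realType) (x : R) : R := pi^-1 * (1 + x ^+ 2)^-1.

Definition cauchy_prob (R : realType) (V : set R) : \bar R :=
  (\int[lebesgue_measure]_(x in V) (cauchy_pdf x)%:E)%E.

Section cauchy_prob.
Context {R : realType}.
Notation mu := (@lebesgue_measure R).

Lemma cauchy_pdf_ge0 (x : R) : 0 <= cauchy_pdf x.
Proof. by rewrite mulr_ge0 ?invr_ge0 ?pi_ge0 ?addr_ge0 ?sqr_ge0. Qed.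

Lemma cauchy_pdfE (x : R) : cauchy_pdf x = pi^-1 * (oneDsqr x)^-1.
Proof. by []. Qed.

Lemma cauchy_pdfN (x : R) : cauchy_pdf (- x) = cauchy_pdf x.
Proof. by rewrite /cauchy_pdf sqrrN. Qed.

Lemma continuous_cauchy_pdf : continuous (@cauchy_pdf R).
Proof.
by move=> x; apply: cvgM; [exact: cvg_cst|exact: continuous_oneDsqrV].
Qed.

Lemma measurable_cauchy_pdf : measurable_fun [set: R] (@cauchy_pdf R).
Proof. exact: continuous_measurable_fun continuous_cauchy_pdf. Qed.

Lemma integral_cauchy_pdf : (\int[mu]_x (cauchy_pdf x)%:E = 1)%E.
Proof.
rewrite ge0_symfun_integralT//; last 3 first.
- exact: cauchy_pdf_ge0.
- exact: continuous_cauchy_pdf.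
- by move=> x; rewrite /= cauchy_pdfN.
rewrite -set_itvcy.
under eq_integral do rewrite cauchy_pdfE EFinM.
rewrite ge0_integralZl//=; last 2 first.
- apply/measurable_EFinP/measurable_funTS.
  exact: continuous_measurable_fun continuous_oneDsqrV.
- by rewrite lee_fin invr_ge0 pi_ge0.
rewrite integral0y_oneDsqr -!EFinM; congr EFin.
by rewrite mulKf ?mulfV// gt_eqF// pi_gt0.
Qed.

Local Notation cauchy := (@cauchy_prob R).

Let cauchy0 : cauchy set0 = 0%E.
Proof. by rewrite /cauchy_prob integral_set0. Qed.

Let cauchy_ge0 A : (0 <= cauchy A)%E.
Proof. by apply: integral_ge0 => x _; rewrite lee_fin cauchy_pdf_ge0. Qed.

Let cauchy_sigma_additive : semi_sigma_additive cauchy.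
Proof.
move=> /= F mF tF mUF; rewrite /cauchy_prob; apply: cvg_toP.
  apply: ereal_nondecreasing_is_cvgn => m n mn.
  apply: lee_sum_nneg_natr => // k _ _; apply: integral_ge0 => /= x Fkx.
  by rewrite lee_fin cauchy_pdf_ge0.
rewrite ge0_integral_bigcup//=.
- apply/measurable_funTS/measurableT_comp => //.
  exact: measurable_cauchy_pdf.
- by move=> x _; rewrite lee_fin cauchy_pdf_ge0.
Qed.

HB.instance Definition _ := isMeasure.Build _ _ _
  cauchy cauchy0 cauchy_ge0 cauchy_sigma_additive.

Let cauchy_setT : cauchy [set: R] = 1%E.
Proof. exact: integral_cauchy_pdf. Qed.

HB.instance Definition _ :=
  @Measure_isProbability.Build _ _ R cauchy cauchy_setT.

End cauchy_prob.

(* Distributions are compared on Borel sets only: the values of a measure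
   outside the sigma-algebra are unspecified. *)
Definition n_center (R : realType) (mu : probability R R) (n : nat) (c : R)
  : Prop :=
  exists (d : measure_display) (T : measurableType d) (P : probability T R)
    (X : 'I_n -> {RV P >-> R}),
    (forall i (A : set R), measurable A ->
       distribution P (X i) A = mu A) /\
    {ae P, forall w, \sum_(i < n) X i w = n%:R * c :> R}.

(* Main.v *)
(* Put [k = n - 1].

   Every point of the interval is an [n]-center.  Let [xi_j] be independent totally skewed
   1-stable variables, [E cos (s xi + phi) = exp (- pi |s| / 2) cos (- s ln |s| + phi)].
   Give [X_i] the weight [1 / pi] on [xi_i] and [- 1 / (k pi)] on the other [xi_j]: the sum of
   the [X_i] vanishes, the moduli multiply to [exp (- |s|)], and since [s ln |s|] is not
   homogeneous the phases add up to a translation by exactly [ln k / pi].  Hence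
   [X_i + ln k / pi] is Cauchy, and a combination with the mirror image of the family
   reaches the intermediate centers.  The variable [xi] is the weak limit of centered means
   of independent copies of exponential / uniform; its density is written down as an
   inverse Fourier transform, whose nonnegativity follows from that of Poisson kernels.

   No other point is one.  If [sum_i x_i = n c] with [c >= 0], truncate [x] to [g x = x + a] on
   [[- a, k a]], [g x = n (c + a)] beyond [k a] and [g x = 0] below [- a]; then
   [sum_i g (x_i) >= n (c + a)], while the Cauchy mean of [g] is
   [a + ln k / pi + O(1 / a)]. *)

Require Import Defs.
From HB Require Import structures.
From mathcomp Require Import all_boot all_order all_algebra.
From mathcomp Require Import all_classical all_reals all_analysis measurable_realfun.
From mathcomp Require Import ring lra.

Set Implicit Arguments.
Unset Strict Implicit.
Unset Printing Implicit Defensive.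

Import Order.TTheory GRing.Theory Num.Theory.
Import numFieldNormedType.Exports.

Local Open Scope classical_set_scope.
Local Open Scope ring_scope.

(** Existence. Pointwise limits of characteristic functions carry no law by themselves. Here the
    limit has modulus [expR (- c * |t|)], so its inverse transform converges absolutely and is a
    mean over an exponential law. Three facts then remain, in a forced order: the candidate density
    is nonnegative, it is integrable (which supplies the dominating function for inversion), and its
    transform is the prescribed limit. Each is proved with an auxiliary damping that is sent to 0.

    Bound. A Cauchy variable has no mean, so the identity [sum_i X_i = n c] cannot be averaged
    directly. Cutting at [- a] and [k a] makes the linear terms cancel: the mass outside
    [[- a, k a]] is about [(1 + 1 / k) / (pi a)], so the term [a] loses about [(1 + 1 / k) / pi];
    the value [n (c + a)] beyond [k a], of mass about [1 / (pi k a)], returns about [n / (pi k)],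
    which is the same number because [n = k + 1]. Only the logarithm of the ratio of the two cuts
    survives. *)

Lemma measurable_cos (R : realType) : measurable_fun [set: R] (@cos R).
Proof. exact: (continuous_measurable_fun (@continuous_cos R)). Qed.

Ltac measurability := repeat first [assumption | exact: measurable_cst
  | exact: measurable_id | exact: measurable_fst | exact: measurable_snd
  | apply: measurable_funD | apply: measurable_funB | apply: measurable_funM
  | apply: measurable_funN
  | apply: measurableT_comp; [exact: measurable_cos|]
  | apply: measurableT_comp; [exact: measurable_expR|]
  | apply: measurableT_comp; [exact: measurable_ln|]
  | apply: measurableT_comp; [exact: normr_measurable|]
  | apply: measurableT_comp; [assumption|]].

(** * Integration *)

Section bounded_integrals.
Context {R : realType}.

Lemma bounded_integrable d (T : measurableType d) (P : probability T R)
    (f : T -> R) (M : R) : measurable_fun setT f -> (forall x, `|f x| <= M) ->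
  P.-integrable setT (EFin \o f).
Proof.
move=> mf fM; apply: measurable_bounded_integrable => //.
  by rewrite -ge0_fin_numE ?measure_ge0// fin_num_measure.
exists M; split; first exact: num_real.
by move=> x Mx y _; apply: le_trans (fM y) _; exact: ltW.
Qed.

Lemma Rintegral_cst_probability d (T : measurableType d) (P : probability T R) (r : R) :
  \int[P]_w r = r.
Proof.
rewrite Rintegral_cst// -[RHS]mulr1; congr (_ * _).
by rewrite -[RHS]/(fine 1%E); congr fine; exact: probability_setT.
Qed.

Lemma EFin_Rintegral d (T : measurableType d) (mu : {measure set T -> \bar R})
    (D : set T) (f : T -> R) : measurable D -> mu.-integrable D (EFin \o f) ->
  (\int[mu]_(x in D) (f x)%:E = (\int[mu]_(x in D) f x)%R%:E)%E.
Proof. by move=> mD fi; rewrite /Rintegral fineK// (integrable_fin_num mD fi). Qed.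

Lemma Rintegral_dominated_cvg d (T : measurableType d)
    (mu : {measure set T -> \bar R}) (D : set T) (f_ : nat -> T -> R)
    (f g : T -> R) : measurable D ->
  (forall n, measurable_fun D (f_ n)) -> measurable_fun D f ->
  (forall x, D x -> f_ n x @[n --> \oo] --> f x) ->
  mu.-integrable D (EFin \o g) ->
  (forall n x, D x -> `|f_ n x| <= g x) ->
  \int[mu]_(x in D) f_ n x @[n --> \oo] --> \int[mu]_(x in D) f x.
Proof.
move=> mD mf_ mf f_f ig f_g.
have [] := @dominated_convergence _ _ _ mu D mD (fun n => EFin \o f_ n) (EFin \o f)
  (EFin \o g).
- by move=> n; exact/measurable_EFinP.
- exact/measurable_EFinP.
- by apply: aeW => x Dx; apply: cvg_EFin; [exact: nearW | exact: f_f].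
- exact: ig.
- by apply: aeW => x n Dx; rewrite lee_fin f_g.
move=> intf _ cvgf; apply: fine_cvg.
by rewrite fineK//; exact: integrable_fin_num.
Qed.

Lemma bounded_cvg d (T : measurableType d) (P : probability T R)
    (f_ : nat -> T -> R) (f : T -> R) (M : R) :
  (forall n, measurable_fun setT (f_ n)) -> measurable_fun setT f ->
  (forall x, f_ n x @[n --> \oo] --> f x) ->
  (forall n x, `|f_ n x| <= M) ->
  \int[P]_x f_ n x @[n --> \oo] --> \int[P]_x f x.
Proof.
move=> mf_ mf f_f f_M.
apply: (@Rintegral_dominated_cvg _ _ _ _ _ _ (fun=> M)) => //.
exact: finite_measure_integrable_cst.
Qed.

Lemma integrable_boundedM d (T : measurableType d) (mu : {measure set T -> \bar R})
    (f p : T -> R) (M : R) : measurable_fun setT f -> (forall x, `|f x| <= M) ->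
  mu.-integrable setT (EFin \o p) -> mu.-integrable setT (EFin \o (fun x => f x * p x)).
Proof.
move=> mf fM ip; apply: eq_integrable (integrableMr measurableT mf _ ip) => //.
exists M; split; first exact: num_real.
by move=> x Mx y _; apply: le_trans (fM y) _; exact: ltW.
Qed.

Section fubini.
Context d1 d2 (T1 : measurableType d1) (T2 : measurableType d2).
Variables (P1 : probability T1 R) (P2 : probability T2 R).
Variables (f : T1 * T2 -> R) (M : R).
Hypotheses (mf : measurable_fun setT f) (fM : forall z, `|f z| <= M).

Let fi : (P1 \x P2)%E.-integrable setT (EFin \o f).
Proof. exact: (@bounded_integrable _ _ (P1 \x P2)%E f M mf fM). Qed.

Lemma measurable_Rintegral1 : measurable_fun setT (fun x => \int[P2]_y f (x, y)).
Proof.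
apply/measurable_EFinP.
rewrite (_ : _ \o _ = fubini_F P2 (EFin \o f)); first exact: (measurable_fubini_F fi).
apply/funext => x; rewrite /fubini_F /= -EFin_Rintegral//.
apply: (@bounded_integrable _ _ _ (fun y => f (x, y)) M) => //.
by apply: measurableT_comp => //; exact: measurable_pair1.
Qed.

Lemma Rintegral12_prod :
  \int[(P1 \x P2)%E]_z f z = \int[P1]_x \int[P2]_y f (x, y).
Proof.
rewrite /Rintegral -integral12_prod_meas1//; congr fine.
apply: eq_integral => x _; rewrite /fubini_F /= EFin_Rintegral//.
apply: (@bounded_integrable _ _ _ (fun y => f (x, y)) M) => //.
by apply: measurableT_comp => //; exact: measurable_pair1.
Qed.

Lemma Rintegral21_prod :
  \int[(P1 \x P2)%E]_z f z = \int[P2]_y \int[P1]_x f (x, y).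
Proof.
rewrite /Rintegral -integral21_prod_meas1//; congr fine.
apply: eq_integral => y _; rewrite /fubini_G /= EFin_Rintegral//.
apply: (@bounded_integrable _ _ _ (fun x => f (x, y)) M) => //.
by apply: measurableT_comp => //; exact: measurable_pair2.
Qed.

Lemma Rintegral_fubini :
  \int[P1]_x \int[P2]_y f (x, y) = \int[P2]_y \int[P1]_x f (x, y).
Proof. by rewrite -Rintegral12_prod Rintegral21_prod. Qed.

End fubini.

Import HBNNSimple.

Section density.
Context d (T : measurableType d).
Variables (mu m : {measure set T -> \bar R}) (p : T -> R).
Hypotheses (mp : measurable_fun setT p) (p0 : forall x, 0 <= p x).
Hypothesis mE : forall A, measurable A -> m A = (\int[mu]_(x in A) (p x)%:E)%E.

(** Both sides pass to the limit along increasing simple functions, and on indicators they agree by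
    [mE]. *)
Lemma ge0_integral_density (f : T -> \bar R) : measurable_fun setT f ->
  (forall x, 0 <= f x)%E ->
  (\int[m]_x f x = \int[mu]_x (f x * (p x)%:E))%E.
Proof.
move=> mf f0; pose f_ := nnsfun_approx measurableT mf.
have f_f x : EFin (f_ n x) @[n --> \oo] --> f x by exact: cvg_nnsfun_approx.
have nd_f x : nondecreasing_seq (fun n => (f_ n x)%:E).
  by move=> a b ab; rewrite lee_fin; exact/lefP/nd_nnsfun_approx.
transitivity (lim (\int[m]_x (f_ n x)%:E @[n --> \oo])%E).
  rewrite -monotone_convergence//=.
  - by apply: eq_integral => x _; exact/esym/cvg_lim.
  - by move=> n; exact/measurable_EFinP.
  - by move=> n x _; rewrite lee_fin.
transitivity (lim (\int[mu]_x ((f_ n x)%:E * (p x)%:E) @[n --> \oo])%E); last first.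
  rewrite -monotone_convergence//=.
  - apply: eq_integral => x _; apply/cvg_lim => //.
    by apply: cvgeZr => //; exact: f_f.
  - by move=> n; apply: emeasurable_funM; exact/measurable_EFinP.
  - by move=> n x _; rewrite mule_ge0 ?lee_fin.
  - by move=> x _ a b ab; rewrite lee_wpmul2r ?lee_fin ?nd_f// -lee_fin nd_f.
apply: congr_lim; apply/funext => n /=.
under eq_integral do rewrite fimfunE -fsumEFin//.
rewrite ge0_integral_fsum//=; last 2 first.
- by move=> r; exact/measurable_EFinP/measurableT_comp.
- by move=> r x _; rewrite EFinM nnfun_muleindic_ge0.
under [RHS]eq_integral.
  move=> x _; rewrite fimfunE -fsumEFin// ge0_mule_fsuml; last first.
    by move=> r; rewrite EFinM nnfun_muleindic_ge0.
  over.
rewrite [RHS]ge0_integral_fsum//=; last 2 first.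
- move=> r; apply: emeasurable_funM; last exact/measurable_EFinP.
  exact/measurable_EFinP/measurableT_comp.
- move=> r x _; apply: mule_ge0; last by rewrite lee_fin.
  by rewrite EFinM nnfun_muleindic_ge0.
apply: eq_fsbigr => r /= rf.
have r0 : (0 <= r)%R by move: rf => /[!inE] -[x _ <-].
rewrite integralZl_indic_nnsfun//= integral_indic// setIT mE//.
rewrite -ge0_integralZl//=; last 2 first.
- exact/measurable_EFinP/measurable_funTS.
- by move=> x _; rewrite lee_fin.
rewrite [LHS]integral_mkcond; apply: eq_integral => x _.
rewrite patchE indicE; case: ifPn => xr; first by rewrite mulr1.
by rewrite mulr0 mul0e.
Qed.

Lemma Rintegral_density (f : T -> R) : measurable_fun setT f ->
  mu.-integrable setT (EFin \o (fun x => f x * p x)) ->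
  \int[m]_x f x = \int[mu]_x (f x * p x).
Proof.
move=> mf fi.
have E (g : T -> R) : measurable_fun setT g -> (forall x, 0 <= g x) ->
   (\int[m]_x (g x)%:E = \int[mu]_x (g x * p x)%:E)%E.
  move=> mg g0; rewrite ge0_integral_density//; exact/measurable_EFinP.
rewrite /Rintegral; congr fine; rewrite integralE [RHS]integralE.
rewrite !(funerpos, funerneg) E//; last exact: measurable_funrpos.
rewrite E//; last exact: measurable_funrneg.
congr (_ - _)%E; apply: eq_integral => x _; congr EFin.
  by rewrite /funrpos maxr_pMl// mul0r.
by rewrite /funrneg -mulNr maxr_pMl// mul0r.
Qed.

End density.

End bounded_integrals.

(** * The fundamental theorem of calculus for global antiderivatives *)

Section ftc.
Context {R : realType}.
Notation mu := (@lebesgue_measure R).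
Implicit Types (f F : R -> R).

(** Asking for the derivative on the whole line makes every one-sided condition at an endpoint a
    consequence of continuity. *)
Definition antiderivative f F := forall x : R, is_derive x 1 F (f x).

Lemma ge0_FTC2y f F a (l : R) : (forall x, a <= x -> 0 <= f x) ->
  continuous f -> antiderivative f F -> F x @[x --> +oo] --> l ->
  (\int[mu]_(x in `[a, +oo[) (f x)%:E = (l - F a)%:E)%E.
Proof.
move=> f0 cf dF Fl.
have cF : continuous F.
  by move=> x; apply: differentiable_continuous; apply/derivable1_diffP; exact: ex_derive.
rewrite (@ge0_continuous_FTC2y _ f F a l)//.
- by apply/continuous_subspaceT.
- by move=> x _; exact: ex_derive.
- by apply: cvg_at_right_filter; exact: cF.
- by move=> x _; rewrite derive1E; exact: derive_val.
Qed.

Lemma FTC2 f F a b : a <= b -> continuous f ->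
  antiderivative f F ->
  \int[mu]_(x in `[a, b]) f x = F b - F a.
Proof.
rewrite le_eqVlt => /predU1P[<- _ _|ab cf dF].
  by rewrite set_itv1 Rintegral_set1 subrr.
have cF : continuous F.
  by move=> x; apply: differentiable_continuous; apply/derivable1_diffP; exact: ex_derive.
rewrite /Rintegral (@continuous_FTC2 _ f F a b)//.
- by apply/continuous_subspaceT.
- split.
  + by move=> x _; exact: ex_derive.
  + by apply: cvg_at_right_filter; exact: cF.
  + by apply: cvg_at_left_filter; exact: cF.
- by move=> x _; rewrite derive1E; exact: derive_val.
Qed.

End ftc.

(** * The Laplace transform of a shifted cosine *)

Section trig_exponential.
Context {R : realType}.
Notation mu := (@lebesgue_measure R).

Lemma cvg_expRNM (e : R) : 0 < e -> expR (- e * t) @[t --> +oo] --> 0.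
Proof.
move=> e0.
rewrite (_ : (fun t => expR (- e * t)) = (fun z => expR (- z)) \o (fun z => e * z)); last first.
  by apply: funext => x /=; rewrite mulNr.
apply: (@cvg_comp _ _ _ _ _ _ (pinfty_nbhs R)); last exact: cvgr_expR.
exact: gt0_cvgMry.
Qed.

Lemma continuous_cosM (z phi : R) : continuous (fun t : R => cos (z * t + phi)).
Proof.
move=> t; apply: continuous_comp; last exact: continuous_cos.
by apply: cvgD; [exact: mulrl_continuous|exact: cvg_cst].
Qed.

Lemma continuous_expRM (e : R) : continuous (fun t : R => expR (e * t)).
Proof.
by move=> t; apply: continuous_comp; [exact: mulrl_continuous|exact: continuous_expR].
Qed.

Lemma integrable_expRN (e : R) : 0 < e ->
  mu.-integrable `[0, +oo[ (EFin \o (fun t => expR (- e * t))).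
Proof.
move=> e0; apply/integrableP; split.
  apply/measurable_EFinP/measurable_funTS.
  exact: continuous_measurable_fun (@continuous_expRM _).
under eq_integral do rewrite /= ger0_norm ?expR_ge0//.
rewrite (@ge0_FTC2y _ _ (fun t => - e^-1 * expR (- e * t)) _ 0) ?ltry//.
- exact: continuous_expRM.
- move=> x; apply: is_derive_eq; rewrite /GRing.scale /=.
  by field; rewrite gt_eqF.
- rewrite -[X in _ --> X](mulr0 (- e^-1)); apply: cvgM; first exact: cvg_cst.
  exact: cvg_expRNM.
Qed.

Lemma integral_expR_cos (e z phi : R) : 0 < e ->
  \int[mu]_(t in `[0, +oo[) (expR (- e * t) * cos (z * t + phi)) =
  (e * cos phi - z * sin phi) / (e ^+ 2 + z ^+ 2).
Proof.
move=> e0.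
have e2z2 : e ^+ 2 + z ^+ 2 != 0 by rewrite gt_eqF// ltr_wpDr ?sqr_ge0// exprn_gt0.
(* [F] is an antiderivative of the integrand plus [expR (- e * t)]. This sum is nonnegative, as
   [ge0_FTC2y] requires; the integral of the added exponential, [e^-1], is subtracted at the end. *)
pose F t : R := - e^-1 * expR (- e * t) +
  expR (- e * t) * (- e * cos (z * t + phi) + z * sin (z * t + phi)) / (e ^+ 2 + z ^+ 2).
have cg : continuous (fun t : R => expR (- e * t) * cos (z * t + phi)).
  by move=> t; apply: cvgM; [exact: continuous_expRM|exact: continuous_cosM].
have ig : mu.-integrable `[0, +oo[ (EFin \o (fun t => expR (- e * t) * cos (z * t + phi))).
  apply: le_integrable (integrable_expRN e0) => //.
    by apply/measurable_EFinP/measurable_funTS; exact: continuous_measurable_fun cg.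
  by move=> t _ /=; rewrite lee_fin normrM ler_piMr// cos_max.
have H : \int[mu]_(t in `[0, +oo[) (expR (- e * t) + expR (- e * t) * cos (z * t + phi)) =
    0 - F 0.
  rewrite /Rintegral (@ge0_FTC2y _ _ F _ 0)//.
  - by move=> x _; rewrite -[X in X + _]mulr1 -mulrDr mulr_ge0 ?expR_ge0//.
  - by move=> t; apply: cvgD; [exact: continuous_expRM|exact: cg].
  - move=> x; rewrite /F; apply: is_derive_eq; rewrite /GRing.scale /=.
    by field; rewrite e2z2 gt_eqF.
  - rewrite /F -[X in _ --> X]addr0; apply: cvgD.
      rewrite -[X in _ --> X](mulr0 (- e^-1)); apply: cvgM; first exact: cvg_cst.
      exact: cvg_expRNM.
    rewrite -[X in _ --> X](mul0r (e ^+ 2 + z ^+ 2)^-1); apply: cvgM; last exact: cvg_cst.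
    apply: norm_cvg0; apply: (@squeeze_cvgr _ _ _ _ (cst 0) (fun t => expR (- e * t) * (`|e| + `|z|))).
    + apply: nearW => t; rewrite normr_ge0/= normrM (ger0_norm (expR_ge0 _)).
      rewrite ler_wpM2l ?expR_ge0// (le_trans (ler_normD _ _))// lerD// normrM.
        by rewrite normrN ler_piMr// cos_max.
      by rewrite ler_piMr// sin_max.
    + exact: cvg_cst.
    + rewrite -[X in _ --> X](mul0r (`|e| + `|z|)); apply: cvgM; last exact: cvg_cst.
      exact: cvg_expRNM.
have H1 : \int[mu]_(t in `[0, +oo[) expR (- e * t) = e^-1.
  rewrite /Rintegral (@ge0_FTC2y _ _ (fun t => - e^-1 * expR (- e * t)) _ 0)/=.
  - by rewrite mulr0 expR0 mulr1 sub0r opprK.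
  - by move=> x _; exact: expR_ge0.
  - exact: continuous_expRM.
  - move=> x; apply: is_derive_eq; rewrite /GRing.scale /=.
    by field; rewrite gt_eqF.
  - rewrite -[X in _ --> X](mulr0 (- e^-1)); apply: cvgM; first exact: cvg_cst.
    exact: cvg_expRNM.
move: H; rewrite RintegralD//; last exact: integrable_expRN.
rewrite H1 /F !mulr0 expR0 !add0r !mulr1 mul1r => H.
rewrite -[LHS](addKr e^-1) H; field.
by rewrite e2z2 gt_eqF.
Qed.

End trig_exponential.

(** * Probabilities given by a density *)

Section density_probability.
Context {R : realType} d (T : measurableType d) (mu : {measure set T -> \bar R}).
Variable p : T -> R.
Hypotheses (mp : measurable_fun setT p) (p0 : forall x, 0 <= p x).
Hypothesis p1 : (\int[mu]_x (p x)%:E = 1)%E.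

Let dens (A : set T) : \bar R := (\int[mu]_(x in A) (p x)%:E)%E.

Let dens0 : dens set0 = 0%E.
Proof. by rewrite /dens integral_set0. Qed.

Let dens_ge0 A : (0 <= dens A)%E.
Proof. by apply: integral_ge0 => x _; rewrite lee_fin. Qed.

Let dens_sigma_additive : semi_sigma_additive dens.
Proof.
move=> /= F mF tF mUF; rewrite /dens ge0_integral_bigcup//=; last 2 first.
- exact/measurable_EFinP/measurable_funTS.
- by move=> x _; rewrite lee_fin.
apply: is_cvg_nneseries => n _ _; exact: dens_ge0.
Qed.

HB.instance Definition _ := isMeasure.Build _ _ _ dens dens0 dens_ge0 dens_sigma_additive.

Let dens_setT : dens setT = 1%E. Proof. exact: p1. Qed.

HB.instance Definition _ := @Measure_isProbability.Build _ _ R dens dens_setT.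

Lemma exists_density_probability : exists P : probability T R,
  forall A, measurable A -> P A = (\int[mu]_(x in A) (p x)%:E)%E.
Proof. by exists dens. Qed.

Lemma bounded_integrableM (f : T -> R) (M : R) : measurable_fun setT f ->
  (forall x, `|f x| <= M) -> mu.-integrable setT (EFin \o (fun x => f x * p x)).
Proof.
move=> mf fM.
have ip : mu.-integrable setT (EFin \o p).
  apply/integrableP; split; first exact/measurable_EFinP.
  by under eq_integral do rewrite /= ger0_norm//; rewrite p1 ltry.
exact: integrable_boundedM fM ip.
Qed.

Lemma Rintegral_probability_density (P : probability T R) (f : T -> R) (M : R) :
  (forall A, measurable A -> P A = (\int[mu]_(x in A) (p x)%:E)%E) ->
  measurable_fun setT f -> (forall x, `|f x| <= M) ->
  \int[P]_x f x = \int[mu]_x (f x * p x).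
Proof.
by move=> PE mf fM; apply: Rintegral_density => //; exact: (bounded_integrableM mf fM).
Qed.

End density_probability.

(** * Exponential and Laplace laws *)

Section exponential_laws.
Context {R : realType}.
Notation mu := (@lebesgue_measure R).

(** The law is described by its integrals of bounded functions, the only way in which it is used. *)
Definition exponential_law (e : R) (E : probability (measurableTypeR R) R) :=
  forall (f : R -> R) M, measurable_fun setT f -> (forall x, `|f x| <= M) ->
  \int[E]_t f t = \int[mu]_(t in `[0, +oo[) (f t * (e * expR (- e * t))).

Lemma exists_exponential (e : R) : 0 < e -> exists E, exponential_law e E.
Proof.
move=> e0.
have p0 x := @exponential_pdf_ge0 R e (ltW e0) x.
have mp := @measurable_exponential_pdf R e.
have p1 := @integral_exponential_pdf R e e0.
have [E EE] := @exists_density_probability R _ (measurableTypeR R) mu _ mp p0 p1.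
exists E => f M mf fM.
rewrite (@Rintegral_probability_density R _ (measurableTypeR R) mu _ mp p0 p1 E f M EE mf fM) [RHS]Rintegral_mkcond.
apply: eq_Rintegral => t _; rewrite /exponential_pdf !patchE.
by case: ifP => //; rewrite mulr0.
Qed.

Lemma exponential_cos (e z phi : R) (E : probability (measurableTypeR R) R) : 0 < e ->
  exponential_law e E ->
  \int[E]_t cos (z * t + phi) = e * (e * cos phi - z * sin phi) / (e ^+ 2 + z ^+ 2).
Proof.
move=> e0 EE.
rewrite (EE _ 1); last 2 first.
- exact: continuous_measurable_fun (@continuous_cosM _ _ _).
- by move=> x; exact: cos_max.
rewrite -mulrA -(integral_expR_cos _ _ e0) -RintegralZl//; last first.
  apply: le_integrable (integrable_expRN e0) => //.
    apply/measurable_EFinP/measurable_funTS; apply: continuous_measurable_fun.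
    by move=> t; apply: cvgM; [exact: continuous_expRM|exact: continuous_cosM].
  by move=> t _ /=; rewrite lee_fin normrM ler_piMr// cos_max.
by apply: eq_Rintegral => t _; ring.
Qed.

(** The summand 1 keeps the integrand nonnegative, so the line can be split at 0 and the left half
    reflected before any integrability is known. The reflection changes [u] into [- u], which
    cancels the sine terms. *)
Lemma integral_laplace_cos (e u phi : R) : 0 < e ->
  (\int[mu]_x (e / 2 * expR (- e * `|x|) * (1 + cos (u * x + phi)))%:E =
   (1 + cos phi * (e ^+ 2 / (e ^+ 2 + u ^+ 2)))%:E)%E.
Proof.
move=> e0.
have e2u2 : e ^+ 2 + u ^+ 2 != 0 by rewrite gt_eqF// ltr_wpDr ?sqr_ge0// exprn_gt0.
pose G (x : R) := e / 2 * expR (- e * `|x|) * (1 + cos (u * x + phi)).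
have G0 x : 0 <= G x by rewrite !mulr_ge0 ?expR_ge0// ?divr_ge0// ltW.
have cG : continuous G.
  move=> x; apply: cvgM.
    apply: cvgM; first exact: cvg_cst.
    apply: (@continuous_comp _ _ _ (fun x : R => `|x|) (fun y => expR (- e * y))).
      exact: norm_continuous.
    exact: continuous_expRM.
  by apply: cvgD; [exact: cvg_cst|exact: continuous_cosM].
have H (v psi : R) : e ^+ 2 + v ^+ 2 != 0 ->
    (\int[mu]_(x in `[0%R, +oo[) (e / 2 * expR (- e * `|x|) * (1 + cos (v * x + psi)))%:E =
    (2^-1 + e / 2 * ((e * cos psi - v * sin psi) / (e ^+ 2 + v ^+ 2)))%:E)%E.
  move=> ev.
  (* The constant 1 is written [cos (0 * x + 0)], so that [integral_expR_cos] computes both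
     summands. *)
  transitivity (\int[mu]_(x in `[0%R, +oo[) (e / 2 * (expR (- e * x) * cos (0 * x + 0)
      + expR (- e * x) * cos (v * x + psi)))%:E)%E.
    apply: eq_integral => x; rewrite inE/= in_itv/= andbT => x0.
    by rewrite ger0_norm// mul0r add0r cos0; congr EFin; ring.
  have I (w p : R) : mu.-integrable `[0, +oo[
      (EFin \o (fun t => expR (- e * t) * cos (w * t + p))).
    apply: le_integrable (integrable_expRN e0) => //.
      apply/measurable_EFinP/measurable_funTS; apply: continuous_measurable_fun.
      by move=> t; apply: cvgM; [exact: continuous_expRM|exact: continuous_cosM].
    by move=> t _ /=; rewrite lee_fin normrM ler_piMr// cos_max.
  rewrite EFin_Rintegral//; last first.
    apply: eq_integrable (integrableZl _ (e / 2) (integrableD _ (I 0 0) (I v psi))) => //.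
  rewrite RintegralZl//; last by apply: eq_integrable (integrableD _ (I 0 0) (I v psi)).
  rewrite RintegralD// !integral_expR_cos// cos0 sin0; congr EFin.
  by field; rewrite ev gt_eqF.
rewrite -(setUv `[0%R, +oo[%classic) ge0_integral_setU//=; last 4 first.
- exact: measurableC.
- by rewrite setUv; apply/measurable_EFinP; exact: (continuous_measurable_fun cG).
- by move=> x _; rewrite lee_fin; exact: G0.
- exact/disj_setPCl.
rewrite H// setCitvr integral_itv_bndo_bndc; last first.
  by apply/measurable_EFinP/measurable_funTS; exact: continuous_measurable_fun cG.
have := @ge0_integration_by_substitutionNy _ G 0; rewrite oppr0 => ->; last 2 first.
- by apply: continuous_subspaceT.
- by move=> x _; exact: G0.
have -> : (\int[mu]_(x in `[0%R, +oo[) ((G \o -%R) x)%:E =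
    \int[mu]_(x in `[0%R, +oo[) (e / 2 * expR (- e * `|x|) *
      (1 + cos ((- u) * x + phi)))%:E)%E.
  by apply: eq_integral => x _; rewrite /= /G normrN (mulrN u) (mulNr u).
rewrite H ?sqrrN// -EFinD; congr EFin.
by field.
Qed.

Lemma integral_laplace (e : R) : 0 < e ->
  (\int[mu]_x (e / 2 * expR (- e * `|x|))%:E = 1)%E.
Proof.
(* For these values the cosine is identically 0 and only the total mass is left. *)
move=> e0; have := @integral_laplace_cos e 0 (pi / 2) e0.
rewrite cos_pihalf mul0r addr0 => <-.
by apply: eq_integral => x _; rewrite mul0r add0r cos_pihalf addr0 mulr1.
Qed.

Lemma integrable_laplace (e : R) : 0 < e ->
  mu.-integrable setT (EFin \o (fun x => expR (- e * `|x|))).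
Proof.
move=> e0; suff H : mu.-integrable setT (EFin \o (fun x => e / 2 * expR (- e * `|x|))).
  apply: eq_integrable (integrableZl _ (2 / e) H) => // x _ /=.
  by rewrite -EFinM; congr EFin; field; rewrite gt_eqF.
apply/integrableP; split; first by apply/measurable_EFinP; measurability.
under eq_integral do rewrite /= ger0_norm ?mulr_ge0 ?expR_ge0 ?divr_ge0 ?(ltW e0)//.
by rewrite integral_laplace// ltry.
Qed.

Lemma exists_laplace (e : R) : 0 < e -> exists L : probability (measurableTypeR R) R,
  (forall (f : R -> R) M, measurable_fun setT f -> (forall x, `|f x| <= M) ->
    \int[L]_t f t = \int[mu]_t (f t * (e / 2 * expR (- e * `|t|)))) /\
  (forall u phi, \int[L]_x cos (u * x + phi) = cos phi * (e ^+ 2 / (e ^+ 2 + u ^+ 2))).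
Proof.
move=> e0; pose p (x : R) := e / 2 * expR (- e * `|x|).
have p0 x : 0 <= p x by rewrite !mulr_ge0 ?expR_ge0// ?divr_ge0// ltW.
have cp : continuous p.
  move=> x; apply: cvgM; first exact: cvg_cst.
  apply: (@continuous_comp _ _ _ (fun x : R => `|x|) (fun y => expR (- e * y))).
    exact: norm_continuous.
  exact: continuous_expRM.
have mp : measurable_fun setT p by exact: continuous_measurable_fun.
have p1 : (\int[mu]_x (p x)%:E = 1)%E by exact: integral_laplace.
have [L LE] := @exists_density_probability R _ (measurableTypeR R) mu _ mp p0 p1.
have LEf := fun f M mf fM =>
  @Rintegral_probability_density R _ (measurableTypeR R) mu _ mp p0 p1 L f M LE mf fM.
exists L; split => // u phi.
have mc : measurable_fun setT (fun x : R => cos (u * x + phi)).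
  exact: continuous_measurable_fun (@continuous_cosM _ _ _).
rewrite (LEf _ 1)//; last by move=> x; exact: cos_max.
have ip := @bounded_integrableM R _ (measurableTypeR R) mu _ mp p0 p1.
have := @integral_laplace_cos e u phi e0.
rewrite EFin_Rintegral//; last first.
  apply: eq_integrable (ip (fun x => 1 + cos (u * x + phi)) 2 _ _) => //.
  - by move=> x _ /=; rewrite mulrC.
  - exact: measurable_funD.
  - move=> x; rewrite (le_trans (ler_normD _ _))// normr1.
    by have := cos_max (u * x + phi); lra.
have -> : \int[mu]_x (e / 2 * expR (- e * `|x|) * (1 + cos (u * x + phi))) =
    \int[mu]_x (p x + cos (u * x + phi) * p x).
  by apply: eq_Rintegral => x _; rewrite /p; ring.
move=> -[].
rewrite RintegralD//.
- by rewrite [X in X + _](_ : _ = 1) => [/addrI//|]; rewrite /Rintegral p1.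
- apply: eq_integrable (ip (fun=> 1) 1 _ _) => //.
  + by move=> x _ /=; rewrite mul1r.
  + by move=> x; rewrite normr1.
- by apply: ip => // x; exact: cos_max.
Qed.

End exponential_laws.

(** * The Poisson kernel *)

Section poisson_kernel.
Context {R : realType}.
Notation mu := (@lebesgue_measure R).

(** This is [pi] times the Cauchy density of scale [e], and also the Laplace transform at [e] of
    [cos (u * t)]. The second reading makes it appear from averaged characteristic functions, the
    first makes it an approximate identity of mass [pi]. *)
Definition poisson_kernel (e u : R) : R := e / (e ^+ 2 + u ^+ 2).
Local Notation K := poisson_kernel.

Lemma poisson_kernelN e u : K e (- u) = K e u.
Proof. by rewrite /K sqrrN. Qed.

Section positive_scale.
Variable e : R.
Hypothesis e0 : 0 < e.

Lemma poisson_kernel_den u : 0 < e ^+ 2 + u ^+ 2.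
Proof. by rewrite ltr_wpDr ?sqr_ge0// exprn_gt0. Qed.

Lemma poisson_kernel_ge0 u : 0 <= K e u.
Proof. by rewrite divr_ge0 ?(ltW e0)// ltW// poisson_kernel_den. Qed.

Lemma poisson_kernel_le u : `|K e u| <= e^-1.
Proof.
rewrite ger0_norm ?poisson_kernel_ge0// /K ler_pdivrMr ?poisson_kernel_den//.
rewrite mulrDr expr2 mulKf ?gt_eqF// lerDl mulr_ge0 ?sqr_ge0//.
by rewrite invr_ge0 ltW.
Qed.

Lemma continuous_poisson_kernel x : continuous (fun y => K e (y - x)).
Proof.
move=> y; apply: cvgM; first exact: cvg_cst.
apply: cvgV; first by rewrite gt_eqF// poisson_kernel_den.
apply: cvgD; first exact: cvg_cst.
have c : (fun z => z - x) z @[z --> y] --> y - x by apply: cvgB; [exact: cvg_id|exact: cvg_cst].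
by rewrite expr2; apply: cvgM.
Qed.

Lemma integral_poisson_kernel_tail (x a : R) :
  (\int[mu]_(y in `[a, +oo[) (K e (y - x))%:E = (pi / 2 - atan ((a - x) / e))%:E)%E.
Proof.
apply: (@ge0_FTC2y _ _ (fun y => atan ((y - x) / e))).
- by move=> y _; exact: poisson_kernel_ge0.
- exact: continuous_poisson_kernel.
- move=> y; apply: is_derive_eq; rewrite /GRing.scale /= /K.
  have := poisson_kernel_den (y - x) => ?.
  field; rewrite !gt_eqF//=.
- apply: (@cvg_comp _ _ _ (fun y => (y - x) / e) (@atan R) _ (pinfty_nbhs R)); last exact: cvgy_atan.
  by apply: (@gt0_cvgMly _ _ _ e^-1 (fun y => y - x)); [rewrite invr_gt0|exact: cvg_addrr].
Qed.

Lemma integral_poisson_kernel (x : R) :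
  (\int[mu]_y (K e (y - x))%:E = pi%:E)%E.
Proof.
have cK := @continuous_poisson_kernel x.
rewrite -(setUv `[0%R, +oo[%classic) ge0_integral_setU//=; last 4 first.
- exact: measurableC.
- by rewrite setUv; apply/measurable_EFinP; exact: (continuous_measurable_fun cK).
- by move=> y _; rewrite lee_fin poisson_kernel_ge0.
- exact/disj_setPCl.
rewrite integral_poisson_kernel_tail setCitvr integral_itv_bndo_bndc; last first.
  by apply/measurable_EFinP/measurable_funTS; exact: (continuous_measurable_fun cK).
have := @ge0_integration_by_substitutionNy _ (fun y => K e (y - x)) 0; rewrite oppr0 => ->; last 2 first.
- by apply: continuous_subspaceT.
- by move=> y _; exact: poisson_kernel_ge0.
have -> : (\int[mu]_(y in `[0%R, +oo[) (((fun y => K e (y - x)) \o -%R) y)%:E =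
    \int[mu]_(y in `[0%R, +oo[) (K e (y - (- x)))%:E)%E.
  by apply: eq_integral => y _ /=; rewrite -poisson_kernelN; congr (K e _)%:E; ring.
rewrite integral_poisson_kernel_tail -EFinD !sub0r opprK mulNr atanN; congr EFin.
by field.
Qed.

Lemma integrable_poisson_kernel x : mu.-integrable setT (EFin \o (fun y => K e (y - x))).
Proof.
apply/integrableP; split.
  by apply/measurable_EFinP; exact: (continuous_measurable_fun (@continuous_poisson_kernel x)).
under eq_integral do rewrite /= ger0_norm ?poisson_kernel_ge0//.
by rewrite integral_poisson_kernel ltry.
Qed.

Lemma Rintegral_poisson_kernel x : \int[mu]_y K e (y - x) = pi.
Proof. by rewrite /Rintegral integral_poisson_kernel. Qed.

End positive_scale.
End poisson_kernel.

(** * The Poisson kernel as an approximate identity *)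

Section approximate_identity.
Context {R : realType}.
Notation mu := (@lebesgue_measure R).
Local Notation K := poisson_kernel.

Lemma invrS_gt0 (m : nat) : 0 < (m.+1%:R : R)^-1.
Proof. by rewrite invr_gt0. Qed.

(** For [|u| >= d] one has [u^2 (1 + d^2) >= d^2 (1 + u^2)]. Off its center the kernel is thus at
    most a multiple of [e] times the fixed integrable kernel of scale 1, and no tail has to be
    estimated. *)
Lemma poisson_kernel_away (e d u : R) : 0 < e -> 0 < d -> d <= `|u| ->
  K e u <= (1 + d ^+ 2) / d ^+ 2 * e * K 1 u.
Proof.
move=> e0 d0 du.
have u2 : d ^+ 2 <= u ^+ 2 by rewrite -(real_normK (num_real u)) lerXn2r ?nnegrE// ltW.
have d2 : 0 < d ^+ 2 by rewrite exprn_gt0.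
have u1 : 0 < 1 + u ^+ 2 by rewrite ltr_pwDl// sqr_ge0.
rewrite /K expr1n.
have -> : (1 + d ^+ 2) / d ^+ 2 * e * (1 / (1 + u ^+ 2)) =
    (1 + d ^+ 2) * e / (d ^+ 2 * (1 + u ^+ 2)).
  by field; rewrite !gt_eqF.
rewrite ler_pdivrMr ?poisson_kernel_den// mulrAC ler_pdivlMr ?mulr_gt0//.
rewrite -[(1 + d ^+ 2) * e * _]mulrA [leRHS]mulrCA ler_pM2l//.
by have := sqr_ge0 e; nra.
Qed.

(** Near [s] the error is controlled by continuity, away from [s] by [poisson_kernel_away].
    Continuity is asked at the point [s] only, since the function [weighted_phase] to which this is
    applied may jump at the origin. *)
Lemma approximate_identity (G : R -> R) (M s : R) :
  measurable_fun setT G -> (forall t, `|G t| <= M) -> {for s, continuous G} ->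
  \int[mu]_t (G t * K m.+1%:R^-1 (t - s)) @[m --> \oo] --> pi * G s.
Proof.
move=> mG GM cG.
have M0 : 0 <= M by rewrite (le_trans _ (GM s)).
have i0 m := @integrable_poisson_kernel R _ (invrS_gt0 m) s.
have i1 := @integrable_poisson_kernel R 1 ltr01 s.
have iG m (H : R -> R) (C : R) : measurable_fun setT H -> (forall t, `|H t| <= C) ->
   mu.-integrable setT (EFin \o (fun t => H t * K m.+1%:R^-1 (t - s))).
  by move=> mH HC; exact: (@integrable_boundedM R _ (measurableTypeR R) mu H _ C mH HC (i0 m)).
have mB : measurable_fun setT (fun t => G t - G s) by exact: measurable_funB.
have GB t : `|G t - G s| <= 2 * M.
  by rewrite (le_trans (ler_normB _ _))// mulr2n mulrDl !mul1r lerD.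
apply/cvgrPdist_le => e e_gt0.
(* The kernel has mass [pi], so this tolerance spends [e / 2] near [s] and leaves [e / 2] for the
   rest. *)
have e4 : 0 < e / (2 * pi) by rewrite divr_gt0// mulr_gt0// pi_gt0.
move/cvgrPdist_le : cG => /(_ _ e4) /nbhs_ballP[d /= d0 dG].
pose C : R := (1 + d ^+ 2) / d ^+ 2.
have C0 : 0 <= C by rewrite divr_ge0 ?addr_ge0 ?sqr_ge0.
have cv : (2 * M * C * pi) * m.+1%:R^-1 @[m --> \oo] --> (2 * M * C * pi) * 0.
  by apply: cvgMr; exact: cvg_harmonic.
rewrite mulr0 in cv.
have e2 : 0 < e / 2 by rewrite divr_gt0.
move/cvgrPdist_le : cv => /(_ _ e2) ev.
near=> m.
set h := m.+1%:R^-1.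
have h0 : 0 < h by exact: invrS_gt0.
have -> : pi * G s = \int[mu]_t (G s * K h (t - s)).
  by rewrite RintegralZl ?Rintegral_poisson_kernel 1?mulrC//; exact: i0.
rewrite distrC -RintegralB//; last 2 first.
- exact: (iG _ _ _ mG GM).
- by apply: (iG m (fun=> G s) M).
under eq_Rintegral do rewrite -mulrBl.
apply: (le_trans (le_normr_Rintegral _ (iG m _ _ mB GB))) => //.
apply: (@le_trans _ _ (\int[mu]_t (e / (2 * pi) * K h (t - s) + 2 * M * C * h * K 1 (t - s)))).
  apply: le_Rintegral => //.
  - exact: (integrable_norm (iG m _ _ mB GB)).
  - apply: eq_integrable (integrableD _ (integrableZl _ (e / (2 * pi)) (i0 m))
      (integrableZl _ (2 * M * C * h) i1)) => //.
  move=> t _; rewrite normrM (ger0_norm (poisson_kernel_ge0 h0 _)).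
  have [td|td] := ltP `|t - s| d.
    have Gd : `|G t - G s| <= e / (2 * pi).
      by rewrite distrC; apply: dG; rewrite /ball/= distrC.
    apply: (@le_trans _ _ (e / (2 * pi) * K h (t - s))).
      by rewrite ler_wpM2r// poisson_kernel_ge0.
    rewrite lerDl mulr_ge0 ?poisson_kernel_ge0//.
    by rewrite mulr_ge0 ?(ltW h0)// mulr_ge0// mulr_ge0.
  have := poisson_kernel_away h0 d0 td; rewrite -/C => KC.
  apply: (@le_trans _ _ (2 * M * (C * h * K 1 (t - s)))).
    by rewrite ler_pM// ?poisson_kernel_ge0.
  rewrite (_ : 2 * M * C * h * _ = 2 * M * (C * h * K 1 (t - s))) ?lerDr; last by ring.
  by rewrite mulr_ge0 ?poisson_kernel_ge0// ltW.
rewrite RintegralD//; last 2 first.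
- by apply: eq_integrable (integrableZl _ (e / (2 * pi)) (i0 m)).
- by apply: eq_integrable (integrableZl _ (2 * M * C * h) i1).
rewrite RintegralZl// RintegralZl//; last exact: (i0 m).
rewrite !Rintegral_poisson_kernel//.
have -> : e / (2 * pi) * pi = e / 2.
  by rewrite invfM mulrA mulfVK// gt_eqF// pi_gt0.
have : `|0 - 2 * M * C * pi * h| <= e / 2 by rewrite /h; near: m; exact: ev.
rewrite sub0r normrN ger0_norm; last first.
  by rewrite mulr_ge0 ?(ltW h0)// mulr_ge0 ?pi_ge0// mulr_ge0// mulr_ge0.
by move=> H; rewrite [leRHS](splitr e) lerD2l (le_trans _ H)// mulrAC.
Unshelve. all: by end_near. Qed.

End approximate_identity.

(** * A law from a limit of characteristic functions *)

Section stable_density.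
Context {R : realType}.
Notation mu := (@lebesgue_measure R).
Local Notation K := poisson_kernel.
Variables (c : R) (theta : R -> R) (chi : nat -> R -> R -> R).
Hypotheses (c0 : 0 < c) (mtheta : measurable_fun setT theta).
Hypothesis chiE : forall N, exists d (T : measurableType d) (P : probability T R) (Y : T -> R),
  measurable_fun setT Y /\ forall t phi, \int[P]_w cos (t * Y w + phi) = chi N t phi.
Hypothesis chi_cvg : forall t phi,
  chi N t phi @[N --> \oo] --> expR (- c * `|t|) * cos (theta t + phi).

Lemma measurable_chi N x : measurable_fun setT (fun t => chi N t (- t * x)).
Proof.
have [d [T [P [Y [mY YE]]]]] := chiE N.
(* [measurable_Rintegral1] asks for a probability on the [t] axis; any one will do. *)
have [E _] := @exists_exponential R 1 ltr01.
have := @measurable_Rintegral1 R _ _ (measurableTypeR R) T E P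
  (fun z => cos (z.1 * Y z.2 + - z.1 * x)) 1.
rewrite (_ : (fun t => chi N t (- t * x)) =
  (fun t => \int[P]_w cos (t * Y w + - t * x))); last first.
  by apply/funext => t; rewrite YE.
by apply; [measurability|move=> z; exact: cos_max].
Qed.

Lemma chi_le1 N t phi : `|chi N t phi| <= 1.
Proof.
have [d [T [P [Y [mY YE]]]]] := chiE N; rewrite -YE.
have i1 : P.-integrable setT (EFin \o (fun w => cos (t * Y w + phi))).
  by apply: (@bounded_integrable _ _ _ _ _ 1); [measurability|move=> w; exact: cos_max].
apply: le_trans (le_normr_Rintegral _ i1) _ => //.
have -> : 1 = \int[P]_w (1 : R).
  by rewrite Rintegral_cst_probability.
apply: le_Rintegral => //; first exact: (integrable_norm i1).
  by apply: (@bounded_integrable _ _ _ _ (fun=> 1) 1) => // w; rewrite normr1.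
by move=> w _; exact: cos_max.
Qed.

(* For [t] exponential of rate [e], the mean of [cos (t * (Y - x))] is
   [e ^ 2 / (e ^ 2 + (Y - x) ^ 2)], hence nonnegative. *)
Lemma chi_smoothing_ge0 N (e x : R) (E : probability (measurableTypeR R) R) : 0 < e ->
  exponential_law e E ->
  0 <= \int[E]_t chi N t (- t * x).
Proof.
move=> e0 EE; have [d [T [P [Y [mY YE]]]]] := chiE N.
under eq_Rintegral do rewrite -YE.
rewrite (@Rintegral_fubini R _ _ (measurableTypeR R) T E P
  (fun z => cos (z.1 * Y z.2 + - z.1 * x)) 1)/=; last 2 first.
- by measurability.
- by move=> z; exact: cos_max.
apply: Rintegral_ge0 => w _.
rewrite (_ : \int[E]_t _ = \int[E]_t cos ((Y w - x) * t + 0)); last first.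
  by apply: eq_Rintegral => t _; congr cos; ring.
rewrite (exponential_cos _ _ e0 EE) cos0 sin0 mulr0 subr0 mulr1.
by rewrite divr_ge0 ?addr_ge0 ?sqr_ge0// mulr_ge0// ltW.
Qed.

Lemma damped_phase_ge0 (e x : R) (E : probability (measurableTypeR R) R) : 0 < e ->
  exponential_law e E ->
  0 <= \int[E]_t (expR (- c * `|t|) * cos (theta t + - t * x)).
Proof.
move=> e0 EE.
have : \int[E]_t chi N t (- t * x) @[N --> \oo] -->
    \int[E]_t (expR (- c * `|t|) * cos (theta t + - t * x)).
  apply: (@bounded_cvg _ _ _ _ _ _ 1).
  - by move=> N; exact: measurable_chi.
  - by measurability.
  - by move=> t; exact: chi_cvg.
  - by move=> N t; exact: chi_le1.
move=> cv; rewrite leNgt; apply/negP => lt0.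
have [N _ /(_ N (leqnn N))] : \forall N \near \oo, \int[E]_t chi N t (- t * x) < 0.
  exact: (cvgr_lt _ cv _ lt0).
by rewrite /= ltNge (chi_smoothing_ge0 N x e0 EE).
Qed.

Variable E : probability (measurableTypeR R) R.
Hypothesis EE : exponential_law c E.

(** On the half-line, [expR (- c * t)] against the law of rate [e] and [expR (- e * t)] against the
    law of rate [c] have the same integrand up to the factor [e / c]. After this exchange the decay
    of the limit is carried by the law [E], and the auxiliary damping is a bounded factor that tends
    to 1. *)
Lemma phase_ge0 (x : R) : 0 <= \int[E]_t cos (theta t + - t * x).
Proof.
have bnd a t : 0 < a -> `|expR (- a * `|t|) * cos (theta t + - t * x)| <= 1.
  move=> a0; rewrite normrM mulr_ile1 ?normr_ge0 ?cos_max// ger0_norm ?expR_ge0//.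
  by rewrite expR_le1 mulNr oppr_le0 mulr_ge0// ltW.
have damped e : 0 < e -> 0 <= \int[E]_t (expR (- e * `|t|) * cos (theta t + - t * x)).
  move=> e0; have [F FE] := exists_exponential e0.
  have := damped_phase_ge0 x e0 FE.
  rewrite (FE _ 1); last 2 first.
  - by measurability.
  - by move=> t; exact: bnd.
  rewrite (EE (M := 1)); last 2 first.
  - by measurability.
  - by move=> t; exact: bnd.
  set I := (X in _ -> 0 <= X); set J := (X in 0 <= X -> _).
  have -> : J = e / c * I; last by rewrite pmulr_rge0// divr_gt0.
  rewrite /I -RintegralZl//; last first.
    apply: le_integrable (integrableZl _ c (integrable_expRN c0)) => //.
      by apply/measurable_EFinP/measurable_funTS; measurability.
    move=> t _; rewrite /= lee_fin normrM ler_piMl//.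
    exact: bnd.
  apply: eq_Rintegral => t; rewrite inE/= in_itv/= andbT => t0.
  by rewrite (ger0_norm t0); field; rewrite gt_eqF.
have : \int[E]_t (expR (- m.+1%:R^-1 * `|t|) * cos (theta t + - t * x)) @[m --> \oo] -->
    \int[E]_t cos (theta t + - t * x).
  apply: (@bounded_cvg _ _ _ _ _ _ 1).
  - by move=> m; measurability.
  - by measurability.
  - move=> t; rewrite -[X in _ --> X]mul1r; apply: cvgMr_tmp.
    have e1 : - m.+1%:R^-1 * `|t| @[m --> \oo] --> - 0 * `|t|.
      by apply: cvgMr_tmp; apply: cvgN; exact: cvg_harmonic.
    rewrite oppr0 mul0r in e1; rewrite -[X in _ --> X]expR0.
    exact: (cvg_comp _ _ e1 (@continuous_expR R 0)).
  - by move=> m t; exact: bnd (invrS_gt0 m).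
move=> cv; rewrite leNgt; apply/negP => lt0.
have [m _ /(_ m (leqnn m))] : \forall m \near \oo,
    \int[E]_t (expR (- m.+1%:R^-1 * `|t|) * cos (theta t + - t * x)) < 0.
  exact: (cvgr_lt _ cv _ lt0).
by rewrite /= ltNge damped// invrS_gt0.
Qed.

End stable_density.

(** * Fourier inversion by damping *)

Section fourier_inversion.
Context {R : realType}.
Notation mu := (@lebesgue_measure R).
Local Notation K := poisson_kernel.

Lemma cosMcos (a b : R) : cos a * cos b = 2^-1 * (cos (a + b) + cos (a - b)).
Proof. by rewrite cosD cosB; field. Qed.

Variables (c : R) (theta : R -> R) (E : probability (measurableTypeR R) R).
Hypotheses (c0 : 0 < c) (mtheta : measurable_fun setT theta).
Hypothesis EE : exponential_law c E.

(** With the density [c * expR (- c * t)] of [E] written out, this is [1 / pi] times the half-line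
    integral of [expR (- c * t) * cos (theta t - t * x)]: the inverse Fourier transform of
    [expR (- c * |t|)] with argument [theta] extended oddly from the positive half-line. *)
Definition inverse_density (x : R) := (pi * c)^-1 * \int[E]_t cos (theta t + - t * x).
Local Notation q := inverse_density.

(** The extension by 0 to the negative axis allows kernels centered at [s] and at [- s] to be
    integrated against it over the whole line. *)
Definition weighted_phase (phi : R) : R -> R :=
  (fun t => cos (theta t + phi) * (c * expR (- c * t))) \_ `[0, +oo[.
Local Notation g := weighted_phase.

Lemma measurable_inverse_density : measurable_fun setT q.
Proof.
apply: measurable_funM; first exact: measurable_cst.
apply: (@measurable_Rintegral1 R _ _ (measurableTypeR R) (measurableTypeR R) E E
  (fun z => cos (theta z.2 + - z.2 * z.1)) 1); last by move=> z; exact: cos_max.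
by measurability.
Qed.

Lemma pic_gt0 : 0 < (pi * c)^-1.
Proof. by rewrite invr_gt0 mulr_gt0// pi_gt0. Qed.

Lemma inverse_density_le x : `|q x| <= (pi * c)^-1.
Proof.
rewrite normrM (ger0_norm (ltW pic_gt0)) ler_piMr ?(ltW pic_gt0)//.
have i1 : E.-integrable setT (EFin \o (fun t => cos (theta t + - t * x))).
  by apply: (@bounded_integrable _ _ _ _ _ 1); [measurability|move=> w; exact: cos_max].
apply: le_trans (le_normr_Rintegral _ i1) _ => //.
rewrite -[leRHS](Rintegral_cst_probability E).
apply: le_Rintegral => //; first exact: (integrable_norm i1).
  by apply: (@bounded_integrable _ _ _ _ (fun=> 1) 1) => // w; rewrite normr1.
by move=> w _; exact: cos_max.
Qed.

Lemma measurable_weighted_phase phi : measurable_fun setT (g phi).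
Proof.
apply/(measurable_restrict _ _ _) => //.
by apply: measurable_funTS; measurability.
Qed.

Lemma weighted_phase_le phi t : `|g phi t| <= c.
Proof.
rewrite /g patchE; case: ifPn; last by rewrite normr0 ltW.
rewrite inE/= in_itv/= andbT => t0.
rewrite normrM mulrC -[leRHS]mulr1 ler_pM ?cos_max// normrM.
rewrite (gtr0_norm c0) ger0_norm ?expR_ge0// ler_piMr ?(ltW c0)//.
by rewrite expR_le1 mulNr oppr_le0 mulr_ge0// ltW.
Qed.

Lemma exponential_poisson phi (e s : R) : 0 < e ->
  \int[E]_t (cos (theta t + phi) * K e (t - s)) = \int[mu]_t (g phi t * K e (t - s)).
Proof.
move=> e0.
have mK : measurable_fun setT (fun t : R => K e (t - s)).
  exact: (continuous_measurable_fun (@continuous_poisson_kernel _ _ e0 s)).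
rewrite (EE (M := e^-1)); last 2 first.
- by measurability.
- move=> t; rewrite normrM -[leRHS]mul1r ler_pM// ?cos_max//.
  exact: poisson_kernel_le.
rewrite Rintegral_mkcond; apply: eq_Rintegral => t _.
by rewrite /g !patchE; case: ifP => _; rewrite ?mul0r//; ring.
Qed.

(* Damping by [expR (- e * `|x|)] makes Fubini applicable: the Laplace law has a Poisson
   kernel as its characteristic function, and letting [e] tend to [0] is an
   approximate identity. *)
Lemma damped_fourier (e s phi : R) : 0 < e ->
  \int[mu]_x (q x * cos (s * x + phi) * expR (- e * `|x|)) =
  (pi * c)^-1 * (\int[mu]_t (g phi t * K e (t - s)) +
                 \int[mu]_t (g (- phi) t * K e (t - (- s)))).
Proof.
move=> e0; have [L [LE Lcos]] := exists_laplace e0.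
have mq := measurable_inverse_density.
have bf x : `|q x * cos (s * x + phi)| <= (pi * c)^-1.
  rewrite normrM -[leRHS]mulr1; apply: ler_pM => //; last exact: cos_max.
  exact: inverse_density_le.
have mf : measurable_fun setT (fun x : R => q x * cos (s * x + phi)) by measurability.
have := LE _ _ mf bf.
have mK u : measurable_fun setT (fun t : R => K e (t - u)).
  exact: (continuous_measurable_fun (@continuous_poisson_kernel _ _ e0 u)).
have iK psi u : E.-integrable setT (EFin \o (fun t => cos (theta t + psi) * K e (t - u))).
  apply: (@bounded_integrable _ _ _ _ _ e^-1).
    by apply: measurable_funM; [measurability|exact: mK].
  move=> t; rewrite normrM -[leRHS]mul1r ler_pM// ?cos_max//.
  exact: poisson_kernel_le.
have -> : \int[L]_x (q x * cos (s * x + phi)) =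
   e / 2 * ((pi * c)^-1 * (\int[mu]_t (g phi t * K e (t - s)) +
                 \int[mu]_t (g (- phi) t * K e (t - (- s))))).
  transitivity (\int[L]_x ((pi * c)^-1 *
      \int[E]_t (cos (theta t + - t * x) * cos (s * x + phi)))).
    apply: eq_Rintegral => x _; rewrite /q -mulrA RintegralZr//.
    by apply: (@bounded_integrable _ _ _ _ _ 1); [measurability|move=> w; exact: cos_max].
  have bcc (z : R * R) : `|cos (theta z.2 + - z.2 * z.1) * cos (s * z.1 + phi)| <= 1.
    by rewrite normrM mulr_ile1 ?normr_ge0 ?cos_max.
  have mcc : measurable_fun setT (fun z : measurableTypeR R * measurableTypeR R =>
      cos (theta z.2 + - z.2 * z.1) * cos (s * z.1 + phi)) by measurability.
  rewrite RintegralZl//; last first.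
    apply: (@bounded_integrable _ _ _ _ _ 1).
      exact: (@measurable_Rintegral1 R _ _ (measurableTypeR R) (measurableTypeR R) L E _ 1 mcc bcc).
    move=> x; rewrite -[leRHS](Rintegral_cst_probability E).
    have i1 : E.-integrable setT (EFin \o (fun t => cos (theta t + - t * x) * cos (s * x + phi))).
      apply: (@bounded_integrable _ _ _ _ _ 1); first by measurability.
      by move=> t; exact: (bcc (x, t)).
    apply: le_trans (le_normr_Rintegral _ i1) _ => //.
    apply: le_Rintegral => //; first exact: (integrable_norm i1).
      by apply: (@bounded_integrable _ _ _ _ (fun=> 1) 1) => // w; rewrite normr1.
    by move=> t _; exact: (bcc (x, t)).
  rewrite (@Rintegral_fubini R _ _ (measurableTypeR R) (measurableTypeR R) L E _ 1 mcc bcc)/=.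
  transitivity ((pi * c)^-1 * \int[E]_t (e / 2 *
      (cos (theta t + phi) * K e (t - s) + cos (theta t + - phi) * K e (t - - s)))).
    congr (_ * _); apply: eq_Rintegral => t _.
    (* The product formula leaves the characteristic function of the Laplace law at the frequencies
       [s - t] and [- (t + s)], hence [e / 2] times the kernels centered at [s] and [- s]. *)
    transitivity (\int[L]_x (2^-1 * (cos ((s - t) * x + (theta t + phi)) +
        cos (- (t + s) * x + (theta t - phi))))).
      apply: eq_Rintegral => x _; rewrite cosMcos; congr (_ * (cos _ + cos _)); ring.
    have il u psi : L.-integrable setT (EFin \o (fun x => cos (u * x + psi))).
      by apply: (@bounded_integrable _ _ _ _ _ 1); [measurability|move=> w; exact: cos_max].
    rewrite RintegralZl//; last by apply: eq_integrable (integrableD _ (il _ _) (il _ _)).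
    rewrite RintegralD// !Lcos /K.
    have -> : (s - t) ^+ 2 = (t - s) ^+ 2 by ring.
    have -> : (- (t + s)) ^+ 2 = (t - - s) ^+ 2 by ring.
    by ring.
  rewrite RintegralZl//; last by apply: eq_integrable (integrableD _ (iK _ _) (iK _ _)).
  rewrite RintegralD// !exponential_poisson//.
  by rewrite mulrCA.
move=> H; apply: (@mulfI _ (e / 2)); first by rewrite gt_eqF// divr_gt0.
rewrite H -RintegralZl//.
  by apply: eq_Rintegral => x _; ring.
apply: (@integrable_boundedM _ _ (measurableTypeR R) mu _ _ _ mf bf).
exact: integrable_laplace.
Qed.

Hypothesis q_ge0 : forall x, 0 <= q x.
Hypothesis ctheta : forall s, 0 < s -> {for s, continuous theta}.
Hypothesis theta0 : theta m.+1%:R^-1 @[m --> \oo] --> 0.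

Lemma weighted_phase_poisson_le phi e s : 0 < e ->
  \int[mu]_t (g phi t * K e (t - s)) <= c * pi.
Proof.
move=> e0; have iK := @integrable_poisson_kernel R e e0 s.
rewrite -(Rintegral_poisson_kernel e0 s) -RintegralZl//.
apply: le_Rintegral => //.
- exact: (@integrable_boundedM _ _ (measurableTypeR R) mu _ _ _
    (@measurable_weighted_phase phi) (@weighted_phase_le phi) iK).
- by apply: eq_integrable (integrableZl _ c iK).
- move=> t _; rewrite ler_wpM2r ?poisson_kernel_ge0//.
  exact: le_trans (ler_norm _) (weighted_phase_le _ _).
Qed.

(** A crude bound suffices here: it gives integrability, which inversion needs for domination, and
    the exact mass is deduced from inversion afterwards. The damping is removed by monotone
    convergence in [damped_fourier] at frequency 0, where each of the two kernel integrals is at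
    most [c * pi]. *)
Lemma integral_inverse_density_le : (\int[mu]_x (q x)%:E <= 2%:E)%E.
Proof.
have mq := measurable_inverse_density.
pose f (m : nat) (x : R) := (q x * expR (- m.+1%:R^-1 * `|x|))%:E.
have mf m : measurable_fun setT (f m) by apply/measurable_EFinP; measurability.
have f0 m x : setT x -> (0 <= f m x)%E.
  by move=> _; rewrite lee_fin mulr_ge0 ?expR_ge0.
have ndf x : setT x -> nondecreasing_seq (f^~ x).
  move=> _ a b ab; rewrite lee_fin ler_wpM2l// ler_expR ler_wpM2r// lerN2.
  by rewrite lef_pV2 ?posrE// ler_nat.
have flim x : limn (f^~ x) = (q x)%:E.
  apply/cvg_lim => //; apply: cvg_EFin; first exact: nearW.
  rewrite -[X in _ --> X]mulr1; apply: cvgMl_tmp.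
  have e1 : - m.+1%:R^-1 * `|x| @[m --> \oo] --> - 0 * `|x|.
    by apply: cvgMr_tmp; apply: cvgN; exact: cvg_harmonic.
  rewrite oppr0 mul0r in e1; rewrite -[X in _ --> X]expR0.
  exact: (cvg_comp _ _ e1 (@continuous_expR R 0)).
have := @cvg_monotone_convergence _ (measurableTypeR R) R mu _ measurableT f mf f0 ndf.
rewrite (_ : (fun x => limn (f^~ x)) = (fun x => (q x)%:E)); last first.
  by apply/funext => x; exact: flim.
apply: cvge_le; apply: nearW => m.
have h0 := @invrS_gt0 R m.
rewrite EFin_Rintegral//; last first.
  exact: (@integrable_boundedM _ _ (measurableTypeR R) mu _ _ _ mq
    inverse_density_le (integrable_laplace h0)).
have := @damped_fourier m.+1%:R^-1 0 0 h0.
rewrite (_ : \int[mu]_x _ = \int[mu]_x (q x * expR (- m.+1%:R^-1 * `|x|))); last first.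
  by apply: eq_Rintegral => x _; rewrite mul0r addr0 cos0 mulr1.
move=> ->; rewrite lee_fin ler_pdivrMl ?mulr_gt0 ?pi_gt0//.
apply: (@le_trans _ _ (c * pi + c * pi)).
  by rewrite lerD// weighted_phase_poisson_le.
by rewrite [pi * c]mulrC mulr_natr mulr2n.
Qed.

Lemma integrable_inverse_density : mu.-integrable setT (EFin \o q).
Proof.
apply/integrableP; split; first by apply/measurable_EFinP; exact: measurable_inverse_density.
under eq_integral do rewrite /= ger0_norm//.
by apply: le_lt_trans integral_inverse_density_le _; exact: ltry.
Qed.

Lemma continuous_weighted_phase phi s : 0 < s -> {for s, continuous (g phi)}.
Proof.
move=> s0.
have c1 : cos (theta t + phi) @[t --> s] --> cos (theta s + phi).
  have e1 : theta t + phi @[t --> s] --> theta s + phi.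
    by apply: cvgD; [exact: ctheta|exact: cvg_cst].
  exact: (cvg_comp _ _ e1 (@continuous_cos R _)).
have c2 : c * expR (- c * t) @[t --> s] --> c * expR (- c * s).
  by apply: cvgMl_tmp; exact: continuous_expRM.
have c3 : cos (theta t + phi) * (c * expR (- c * t)) @[t --> s] -->
    cos (theta s + phi) * (c * expR (- c * s)) by exact: cvgM c1 c2.
rewrite /prop_for /continuous_at {2}/g patchE ifT; last first.
  by rewrite inE/= in_itv/= andbT ltW.
apply: cvg_trans c3; apply: near_eq_cvg; near=> t.
rewrite /g patchE ifT// inE/= in_itv/= andbT ltW//.
by near: t; exact: lt_nbhsr.
Unshelve. all: by end_near. Qed.

Lemma continuous_weighted_phaseN phi s : 0 < s ->
  {for - s, continuous (g phi)} /\ g phi (- s) = 0.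
Proof.
move=> s0; have gN t : t < 0 -> g phi t = 0.
  move=> t0; rewrite /g patchE ifF//; apply/negbTE.
  by rewrite notin_setE/= in_itv/= andbT; apply/negP; rewrite -ltNge.
have sN : - s < 0 by rewrite oppr_lt0.
split; last exact: gN.
rewrite /prop_for /continuous_at gN//.
have c1 : (fun=> 0 : R) t @[t --> - s] --> (0 : R) by exact: cvg_cst.
apply: cvg_trans c1; apply: near_eq_cvg; near=> t.
rewrite gN//; near: t; exact: lt_nbhsl.
Unshelve. all: by end_near. Qed.

(** Let the damping in [damped_fourier] vanish. For [s > 0] the kernel at [s] reproduces
    [weighted_phase], and the kernel at [- s] sees only the zero extension and contributes nothing
    in the limit. *)
Lemma fourier_inversion s phi : 0 < s ->
  \int[mu]_x (q x * cos (s * x + phi)) = expR (- c * s) * cos (theta s + phi).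
Proof.
move=> s0; have mq := measurable_inverse_density.
have cvL : \int[mu]_x (q x * cos (s * x + phi) * expR (- m.+1%:R^-1 * `|x|)) @[m --> \oo]
    --> \int[mu]_x (q x * cos (s * x + phi)).
  apply: (@Rintegral_dominated_cvg _ _ (measurableTypeR R) mu setT _ _ q) => //.
  - by move=> m; measurability.
  - by measurability.
  - move=> x _; rewrite -[X in _ --> X]mulr1; apply: cvgMl_tmp.
    have e1 : - m.+1%:R^-1 * `|x| @[m --> \oo] --> - 0 * `|x|.
      by apply: cvgMr_tmp; apply: cvgN; exact: cvg_harmonic.
    rewrite oppr0 mul0r in e1; rewrite -[X in _ --> X]expR0.
    exact: (cvg_comp _ _ e1 (@continuous_expR R 0)).
  - exact: integrable_inverse_density.
  - move=> m x _; rewrite normrM (normrM (q x)) (ger0_norm (q_ge0 x)) -mulrA ler_piMr//.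
    rewrite mulr_ile1 ?cos_max// ger0_norm ?expR_ge0//.
have cvR : (pi * c)^-1 * (\int[mu]_t (g phi t * K m.+1%:R^-1 (t - s)) +
      \int[mu]_t (g (- phi) t * K m.+1%:R^-1 (t - (- s)))) @[m --> \oo] -->
    (pi * c)^-1 * (pi * g phi s + pi * g (- phi) (- s)).
  apply: cvgMl_tmp; apply: cvgD; apply: approximate_identity.
  - exact: measurable_weighted_phase.
  - exact: weighted_phase_le.
  - exact: continuous_weighted_phase.
  - exact: measurable_weighted_phase.
  - exact: weighted_phase_le.
  - by have [] := continuous_weighted_phaseN (- phi) s0.
have [_ gN] := continuous_weighted_phaseN (- phi) s0.
have limE : (pi * c)^-1 * (pi * g phi s + pi * g (- phi) (- s)) =
    expR (- c * s) * cos (theta s + phi).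
  rewrite gN mulr0 addr0 /g patchE ifT; last by rewrite inE/= in_itv/= andbT ltW.
  have := @pi_gt0 R; move: (pi : R) => p p0.
  by field; rewrite !gt_eqF.
rewrite limE in cvR.
have E1 : (fun m : nat => \int[mu]_x (q x * cos (s * x + phi) * expR (- m.+1%:R^-1 * `|x|)))
   = (fun m : nat => (pi * c)^-1 * (\int[mu]_t (g phi t * K m.+1%:R^-1 (t - s)) +
      \int[mu]_t (g (- phi) t * K m.+1%:R^-1 (t - (- s))))).
  by apply/funext => m; rewrite damped_fourier.
by move: cvL; rewrite E1 => cvL; exact: (cvg_unique _ cvL cvR).
Qed.

(** At [s = 0] both kernels would sit on the possible jump of [weighted_phase], so the mass is
    obtained by letting [s = 1 / (m + 1)] tend to 0 in [fourier_inversion]; this is where [theta0]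
    enters. *)
Lemma integral_inverse_density : (\int[mu]_x (q x)%:E = 1)%E.
Proof.
have mq := measurable_inverse_density; have iq := integrable_inverse_density.
rewrite EFin_Rintegral//; congr EFin.
have cvL : \int[mu]_x (q x * cos (m.+1%:R^-1 * x + 0)) @[m --> \oo] --> \int[mu]_x q x.
  apply: (@Rintegral_dominated_cvg _ _ (measurableTypeR R) mu setT _ _ q) => //.
  - by move=> m; measurability.
  - move=> x _; rewrite -[X in _ --> X]mulr1; apply: cvgMl_tmp.
    rewrite -[X in _ --> X]cos0.
    have e1 : m.+1%:R^-1 * x + 0 @[m --> \oo] --> 0 * x + 0.
      by apply: cvgD; [apply: cvgMr_tmp; exact: cvg_harmonic|exact: cvg_cst].
    rewrite mul0r addr0 in e1.
    exact: (cvg_comp _ _ e1 (@continuous_cos R 0)).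
  - by move=> m x _; rewrite normrM (ger0_norm (q_ge0 x)) ler_piMr// cos_max.
have cvR : expR (- c * m.+1%:R^-1) * cos (theta m.+1%:R^-1 + 0) @[m --> \oo] --> (1 : R).
  rewrite -[X in _ --> X]mulr1; apply: cvgM.
    have e1 : - c * m.+1%:R^-1 @[m --> \oo] --> - c * 0.
      by apply: cvgMl_tmp; exact: cvg_harmonic.
    rewrite mulr0 in e1; rewrite -[X in _ --> X]expR0.
    exact: (cvg_comp _ _ e1 (@continuous_expR R 0)).
  rewrite -[X in _ --> X]cos0.
  have e1 : theta m.+1%:R^-1 + 0 @[m --> \oo] --> 0 + 0.
    by apply: cvgD; [exact: theta0|exact: cvg_cst].
  rewrite addr0 in e1.
  exact: (cvg_comp _ _ e1 (@continuous_cos R 0)).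
have E1 : (fun m : nat => \int[mu]_x (q x * cos (m.+1%:R^-1 * x + 0))) =
    (fun m : nat => expR (- c * m.+1%:R^-1) * cos (theta m.+1%:R^-1 + 0)).
  by apply/funext => m; rewrite fourier_inversion// invrS_gt0.
by move: cvL; rewrite E1 => cvL; exact: (cvg_unique _ cvL cvR).
Qed.

Lemma exists_law_of_phase : exists L : probability (measurableTypeR R) R,
  forall s phi, 0 < s ->
  \int[L]_x cos (s * x + phi) = expR (- c * s) * cos (theta s + phi).
Proof.
have mq := measurable_inverse_density.
have [L LE] := @exists_density_probability R _ (measurableTypeR R) mu _ mq q_ge0
  integral_inverse_density.
exists L => s phi s0.
rewrite (@Rintegral_probability_density R _ (measurableTypeR R) mu _ mq q_ge0
  integral_inverse_density L _ 1 LE).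
- by rewrite -fourier_inversion//; apply: eq_Rintegral => x _; rewrite mulrC.
- by measurability.
- by move=> x; exact: cos_max.
Qed.

End fourier_inversion.

(** * The skewed 1-stable law *)

Section characteristic_function.
Context {R : realType}.

(* [rho] and [beta] are the modulus and the argument of the characteristic function at
   one point; letting the phase [phi] vary encodes its real and imaginary parts. *)
Definition has_cf d (T : measurableType d) (P : probability T R) (Y : T -> R)
  (rho beta : R) := forall phi, \int[P]_w cos (Y w + phi) = rho * cos (beta + phi).

Lemma has_cf_independent d1 d2 (T1 : measurableType d1) (T2 : measurableType d2)
    (P1 : probability T1 R) (P2 : probability T2 R) (Y1 : T1 -> R) (Y2 : T2 -> R)
    (r1 r2 b1 b2 : R) : measurable_fun setT Y1 -> measurable_fun setT Y2 ->
  has_cf P1 Y1 r1 b1 -> has_cf P2 Y2 r2 b2 ->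
  has_cf (P1 \x P2)%E (fun z => Y1 z.1 + Y2 z.2) (r1 * r2) (b1 + b2).
Proof.
move=> m1 m2 h1 h2 phi.
rewrite (@Rintegral12_prod R _ _ T1 T2 P1 P2 (fun z => cos (Y1 z.1 + Y2 z.2 + phi)) 1)/=;
  last 2 first.
- by measurability.
- by move=> z; exact: cos_max.
transitivity (\int[P1]_x (r2 * cos (Y1 x + (b2 + phi)))).
  apply: eq_Rintegral => x _.
  rewrite (_ : Y1 x + (b2 + phi) = b2 + (Y1 x + phi)); last by ring.
  by rewrite -h2; apply: eq_Rintegral => y _; congr cos; ring.
rewrite RintegralZl//; last first.
  by apply: (@bounded_integrable _ _ _ _ _ 1); [measurability|move=> w; exact: cos_max].
by rewrite h1 mulrCA mulrA addrA.
Qed.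

(** Independence is recorded only through the characteristic functions of weighted sums, for all
    weights at once. Each induction step multiplies the space by one more copy of [T]. *)
Lemma exists_iid d (T : measurableType d) (P : probability T R) (Y : T -> R) m :
  measurable_fun setT Y ->
  exists d' (T' : measurableType d') (P' : probability T' R) (Z : nat -> T' -> R),
    (forall i, measurable_fun setT (Z i)) /\
    forall a rho beta : nat -> R,
      (forall i, has_cf P (fun w => a i * Y w) (rho i) (beta i)) ->
      has_cf P' (fun w => \sum_(i < m) a i * Z i w)
        (\prod_(i < m) rho i) (\sum_(i < m) beta i).
Proof.
move=> mY; elim: m => [|m [d' [T' [P' [Z [mZ ZE]]]]]].
  exists d, T, P, (fun=> Y); split => // a rho beta _ phi.
  under eq_Rintegral do rewrite big_ord0.
  by rewrite !big_ord0 mul1r Rintegral_cst_probability.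
exists _, (T' * T)%type, (P' \x P)%E,
  (* Indices beyond [m] repeat the last coordinate; the sum over [i < m.+1] never reaches them. *)
  (fun i z => if (i < m)%N then Z i z.1 else Y z.2); split.
  move=> i; case: (i < m)%N; first by apply: measurableT_comp.
  by apply: measurableT_comp.
move=> a rho beta YE phi.
have mS : measurable_fun setT (fun w => \sum_(i < m) a i * Z i w).
  by apply: measurable_sum => i; apply: measurable_funM.
have mY' : measurable_fun setT (fun w => a m * Y w) by apply: measurable_funM.
have := has_cf_independent mS mY' (ZE a rho beta YE) (YE m) phi.
rewrite !big_ord_recr/= => <-; apply: eq_Rintegral => z _.
rewrite big_ord_recr/= ltnn; congr cos; congr (_ + _); congr (_ + _).
by apply: eq_bigr => i _; rewrite ltn_ord.
Qed.

End characteristic_function.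

(** * A heavy-tailed law with an elementary characteristic function *)

Section heavy_tail.
Context {R : realType}.
Notation mu := (@lebesgue_measure R).

(** The interval is open at 0 so that [r > 0] is at hand when [1 / r] is formed. *)
Lemma exists_uniform : exists U : probability (measurableTypeR R) R,
  forall (f : R -> R) M, measurable_fun setT f -> (forall x, `|f x| <= M) ->
  \int[U]_t f t = \int[mu]_(t in `]0, 1]) f t.
Proof.
have p0 x := @uniform_pdf_ge0 R 0 1 x ltr01.
have mp := @measurable_uniform_pdf R 0 1.
have p1 := @integral_uniform_pdf1 R 0 1 setT ltr01 (@subsetT _ _).
have [U UE] := @exists_density_probability R _ (measurableTypeR R) mu _ mp p0 p1.
exists U => f M mf fM.
rewrite (@Rintegral_probability_density R _ (measurableTypeR R) mu _ mp p0 p1 U f M UE mf fM).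
rewrite Rintegral_itv_obnd_cbnd; last first.
  apply: (@measurable_bounded_integrable _ (measurableTypeR R)) => //.
  - by rewrite /= lebesgue_measure_itv/=; case: ifP => _; rewrite ?ltry.
  - exact: measurable_funTS.
  - exists M; split; first exact: num_real.
    by move=> x Mx y _; apply: le_trans (fM y) _; exact: ltW.
rewrite [RHS]Rintegral_mkcond.
apply: eq_Rintegral => t _; rewrite patchE /uniform_pdf subr0 invr1.
have -> : (t \in `[0, 1]%classic) = (0 <= t <= 1) by rewrite mem_setE in_itv.
by case: ifP => _; rewrite ?mulr0 ?mulr1.
Qed.

(* An exponential variable divided by an independent uniform one has tail [~ 1/x],
   and its characteristic function is elementary.  In the proof [expR (- ln u)]
   stands for [1 / u] on the support of the uniform law. *)
Lemma exists_heavy_tail : exists d (T : measurableType d) (P : probability T R) (Y : T -> R),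
  measurable_fun setT Y /\ forall s phi, 0 < s ->
    \int[P]_w cos (s * Y w + phi) = (1 - s * atan s^-1) * cos phi -
      s / 2 * (ln (1 + s ^+ 2) - ln (s ^+ 2)) * sin phi.
Proof.
have [U UE] := exists_uniform.
have [E EE] := @exists_exponential R 1 ltr01.
exists _, (measurableTypeR R * measurableTypeR R)%type, (U \x E)%E,
  (fun z => z.2 * expR (- ln z.1)); split; first by measurability.
move=> s phi s0.
have s2 : 0 < s ^+ 2 by rewrite exprn_gt0.
have bf (z : R * R) : `|cos (s * (z.2 * expR (- ln z.1)) + phi)| <= 1 by exact: cos_max.
have mf : measurable_fun setT (fun z : measurableTypeR R * measurableTypeR R =>
  cos (s * (z.2 * expR (- ln z.1)) + phi)) by measurability.
rewrite (@Rintegral12_prod R _ _ (measurableTypeR R) (measurableTypeR R) U E _ 1 mf bf)/=.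
rewrite (UE _ 1); last 2 first.
- exact: (@measurable_Rintegral1 R _ _ (measurableTypeR R) (measurableTypeR R) U E _ 1 mf bf).
- move=> x; rewrite -[leRHS](Rintegral_cst_probability E).
  have i1 : E.-integrable setT (EFin \o (fun t => cos (s * (t * expR (- ln x)) + phi))).
    by apply: (@bounded_integrable _ _ _ _ _ 1); [measurability|move=> t; exact: cos_max].
  apply: le_trans (le_normr_Rintegral _ i1) _ => //.
  apply: le_Rintegral => //; first exact: (integrable_norm i1).
    by apply: (@bounded_integrable _ _ _ _ (fun=> 1) 1) => // w; rewrite normr1.
  by move=> t _; exact: cos_max.
(* The inner exponential mean at frequency [s / r], with [r ^+ 2] cleared from the denominators; in
   this form it is continuous at [r = 0] too. *)
pose h (r : R) := (r ^+ 2 * cos phi - s * r * sin phi) / (r ^+ 2 + s ^+ 2).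
have rs r : 0 < r ^+ 2 + s ^+ 2 by rewrite ltr_wpDl ?sqr_ge0.
have ch : continuous h.
  move=> r; have cr : (x : R) @[x --> r] --> r by exact: cvg_id.
  have cr2 : x ^+ 2 @[x --> r] --> r ^+ 2 by rewrite expr2; apply: cvgM.
  apply: cvgM.
    by apply: cvgB; apply: cvgMr_tmp => //; apply: cvgMl_tmp.
  by apply: cvgV; [rewrite gt_eqF|apply: cvgD => //; exact: cvg_cst].
transitivity (\int[mu]_(r in `]0, 1]) h r).
  apply: eq_Rintegral => r; rewrite inE/= in_itv/= => /andP[r0 _].
  transitivity (\int[E]_t cos ((s / r) * t + phi)).
    apply: eq_Rintegral => t _; rewrite expRN lnK ?posrE//; congr cos; ring.
  rewrite (exponential_cos _ _ ltr01 EE) /h.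
  by field; rewrite !gt_eqF// ?rs// [X in 0 < X]addrC rs.
have ih : mu.-integrable `[0, 1] (EFin \o h).
  apply: continuous_compact_integrable; first exact: segment_compact.
  exact: continuous_subspaceT.
rewrite Rintegral_itv_obnd_cbnd; last first.
  by apply: integrableS ih => //; exact: subset_itv_oc_cc.
have dh : antiderivative h (fun r => cos phi * (r - s * atan (s^-1 * r)) -
    s / 2 * sin phi * ln (r ^+ 2 + s ^+ 2)).
  move=> r; have rs0 := rs r.
  have dq : is_derive r 1 (fun x : R => x ^+ 2 + s ^+ 2) (2 * r).
    by apply: is_derive_eq; rewrite /GRing.scale /=; ring.
  have dl : is_derive r 1 (fun x : R => ln (x ^+ 2 + s ^+ 2)) ((r ^+ 2 + s ^+ 2)^-1 * (2 * r)).
    exact: (@is_derive1_comp _ (@ln R) _ r _ _ (is_derive1_ln rs0) dq).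
  apply: is_derive_eq; rewrite /GRing.scale /= /h.
  by field; rewrite !gt_eqF.
rewrite (FTC2 ler01 ch dh).
rewrite expr1n expr0n/= mulr0 atan0 mulr0 subrr mulr0 add0r mulr1.
by rewrite add0r; ring.
Qed.

End heavy_tail.

(** * Bounds for the arctangent and the logarithm *)

Section elementary_bounds.
Context {R : realType}.

Lemma atan_mvt (x : R) : 0 < x -> exists2 y, 0 < y < x & atan x = x / (1 + y ^+ 2).
Proof.
move=> x0.
have [|y] := @MVT R atan (fun y => (1 + y ^+ 2)^-1) 0 x x0.
  by apply: continuous_subspaceT => y; exact: continuous_atan.
rewrite in_itv/= atan0 !subr0 => yx E; exists y => //.
by rewrite E mulrC.
Qed.

Lemma atan_lt (x : R) : 0 < x -> atan x < x.
Proof.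
move=> x0; have [y /andP[y0 _] ->] := atan_mvt x0.
have y1 : 1 < 1 + y ^+ 2 by rewrite ltrDl exprn_gt0.
by rewrite ltr_pdivrMr ?(lt_trans ltr01 y1)// ltr_pMr.
Qed.

Lemma atan_ge_div (x : R) : 0 <= x -> x / (1 + x ^+ 2) <= atan x.
Proof.
rewrite le_eqVlt => /predU1P[<-|x0]; first by rewrite mul0r atan0.
have [y /andP[y0 yx] ->] := atan_mvt x0.
rewrite ler_pM2l// lef_pV2 ?posrE ?ltr_pwDl ?sqr_ge0// lerD2l.
by rewrite lerXn2r ?nnegrE//; exact: ltW.
Qed.

Lemma atan_bounds (x : R) : 0 <= x -> x - x ^+ 3 <= atan x <= x.
Proof.
move=> x0; apply/andP; split.
  apply: le_trans (atan_ge_div x0).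
  rewrite ler_pdivlMr ?ltr_pwDl ?sqr_ge0//.
  have -> : (x - x ^+ 3) * (1 + x ^+ 2) = x - x ^+ 5 by ring.
  by rewrite lerBlDr lerDl exprn_ge0.
move: x0; rewrite le_eqVlt => /predU1P[<-|x0]; first by rewrite atan0.
exact/ltW/atan_lt.
Qed.

Lemma ln1B_bounds (u : R) : 0 <= u < 1 -> - (u / (1 - u)) <= ln (1 - u) <= - u.
Proof.
move=> /andP[u0 u1]; have v0 : 0 < 1 - u by rewrite subr_gt0.
apply/andP; split; last by apply: le_ln1Dx; rewrite ltrN2.
rewrite -[ln _]opprK -lnV ?posrE// lerN2.
rewrite (_ : ln _ = ln (1 + u / (1 - u))); last by congr ln; field; rewrite gt_eqF.
by apply: le_ln1Dx; rewrite (lt_le_trans (ltrN10 _))// divr_ge0// ltW.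
Qed.

(** As [C > 0], the point [C + i S] lies in the right half-plane and [atan (S / C)] is its argument
    without any branch correction. *)
Lemma polar_form (C S phi : R) : 0 < C ->
  C * cos phi - S * sin phi =
  C * Num.sqrt (1 + (S / C) ^+ 2) * cos (atan (S / C) + phi).
Proof.
move=> C0; set w := S / C.
have q0 : Num.sqrt (1 + w ^+ 2) != 0.
  by rewrite gt_eqF// sqrtr_gt0 ltr_pwDl ?sqr_ge0.
have sinE : sin (atan w) = w * (Num.sqrt (1 + w ^+ 2))^-1.
  rewrite -{2}(@atanK R w) /tan cos_atan mulfVK//.
  by rewrite invr_eq0.
rewrite cosD cos_atan sinE.
have -> : S = w * C by rewrite /w mulfVK// gt_eqF.
by field.
Qed.

Lemma lnX_le (x : R) n : 0 < x -> ln (x ^+ n) <= n%:R * x.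
Proof.
move=> x0; rewrite lnXn// -[leLHS]mulr_natl ler_wpM2l//.
exact/ltW/ln_sublinear.
Qed.

End elementary_bounds.

(** * The limit theorem for means centered by a logarithm *)

Section central_limit.
Context {R : realType}.
Variable t : R.
Hypothesis t0 : 0 < t.

(* Along the fourth powers [N m], the quantities [ln N / N] and [(ln N)^2 / N] are
   bounded by powers of [1 / (m + 1)], since [ln (x ^ 4) <= 4 x]. *)
Let h (m : nat) : R := m.+1%:R^-1.
Let N (m : nat) : nat := (m.+1 ^ 4)%N.
Let L (m : nat) : R := ln (N m)%:R.
Let s (m : nat) : R := t / (N m)%:R.
(** [C m] and [S m] are the real and imaginary parts of the heavy-tailed characteristic function at
    [s m], and [w m] is the tangent of its argument. *)
Let C (m : nat) : R := 1 - s m * atan (s m)^-1.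
Let S (m : nat) : R := s m / 2 * (ln (1 + s m ^+ 2) - ln (s m ^+ 2)).
Let w (m : nat) : R := S m / C m.

Let N_gt0 m : 0 < (N m)%:R :> R.
Proof. by rewrite ltr0n expn_gt0. Qed.

Let s_gt0 m : 0 < s m. Proof. by rewrite divr_gt0. Qed.

Let h_ge0 m : 0 <= h m. Proof. by rewrite invr_ge0. Qed.

Let cvg_h : h m @[m --> \oo] --> 0. Proof. exact: cvg_harmonic. Qed.

Let NV m : (N m)%:R^-1 = h m ^+ 4.
Proof. by rewrite /N natrX exprVn. Qed.

Let L_ge0 m : 0 <= L m.
Proof. by rewrite ln_ge0// ler1n expn_gt0. Qed.

Let L_le m : L m * h m <= 4.
Proof.
rewrite /L /N natrX /h ler_pdivrMr//.
exact: lnX_le.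
Qed.

Let cvg_hX k : h m ^+ k.+1 @[m --> \oo] --> 0.
Proof.
elim: k => [|k ih]; first by under eq_fun do rewrite expr1; exact: cvg_h.
rewrite (_ : (fun m => h m ^+ k.+2) = (fun m => h m * h m ^+ k.+1)); last first.
  by apply/funext => m; rewrite exprS.
by rewrite -[X in _ --> X](mulr0 0); exact: cvgM cvg_h ih.
Qed.

Let cvg_L : L m / (N m)%:R @[m --> \oo] --> 0.
Proof.
have c0 : 4 * h m ^+ 3 @[m --> \oo] --> (4 * 0 : R) by apply: cvgMl_tmp; exact: cvg_hX.
rewrite mulr0 in c0; apply: squeeze_cvgr (cvg_cst 0) c0.
apply: nearW => m; rewrite NV mulr_ge0 ?exprn_ge0//=.
by rewrite exprS mulrA ler_wpM2r ?exprn_ge0.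
Qed.

Let cvg_L2 : L m ^+ 2 / (N m)%:R @[m --> \oo] --> 0.
Proof.
have c0 : 16 * h m ^+ 2 @[m --> \oo] --> (16 * 0 : R) by apply: cvgMl_tmp; exact: cvg_hX.
rewrite mulr0 in c0; apply: squeeze_cvgr (cvg_cst 0) c0.
apply: nearW => m; rewrite NV mulr_ge0 ?exprn_ge0//=.
rewrite (_ : L m ^+ 2 * h m ^+ 4 = (L m * h m) ^+ 2 * h m ^+ 2); last by ring.
rewrite ler_wpM2r ?exprn_ge0// (_ : 16 = 4 ^+ 2); last by ring.
by rewrite lerXn2r ?nnegrE ?mulr_ge0.
Qed.

Let cvg_NV : (N m)%:R^-1 @[m --> \oo] --> (0 : R).
Proof. by under eq_fun do rewrite NV; exact: cvg_hX. Qed.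

Let cvg_s : s m @[m --> \oo] --> 0.
Proof. by rewrite -(mulr0 t); apply: cvgMl_tmp; exact: cvg_NV. Qed.

(** The factor [N] cancels that in [s], and the limit of the arctangent at infinity produces the
    rate [pi / 2]. *)
Let cvg_Nu : (N m)%:R * (s m * atan (s m)^-1) @[m --> \oo] --> t * (pi / 2).
Proof.
have E m : (N m)%:R * (s m * atan (s m)^-1) = t * atan (s m)^-1.
  by rewrite mulrA /s mulrCA mulfV ?gt_eqF// mulr1.
under eq_fun do rewrite E.
have e1 : (s m)^-1 @[m --> \oo] --> +oo%R.
  rewrite -gtr0_cvgV0; last by apply: nearW => m; rewrite invr_gt0.
  rewrite (_ : _ @ \oo = s @ \oo); first exact: cvg_s.
  by congr (_ @ \oo); apply/funext => m; exact: invrK.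
by apply: cvgMl_tmp; exact: (cvg_comp _ _ e1 (@cvgy_atan R)).
Qed.

Let cvg_u : s m * atan (s m)^-1 @[m --> \oo] --> 0.
Proof.
have c1 : (N m)%:R * (s m * atan (s m)^-1) * (N m)%:R^-1 @[m --> \oo] -->
    t * (pi / 2) * 0 by exact: cvgM cvg_Nu cvg_NV.
rewrite mulr0 in c1; apply: cvg_trans c1; apply: near_eq_cvg; near=> m.
by rewrite /= mulrAC mulfV ?gt_eqF// mul1r.
Unshelve. all: by end_near. Qed.

Let cvg_C : C m @[m --> \oo] --> (1 : R).
Proof. by rewrite -[X in _ --> X]subr0; apply: cvgB; [exact: cvg_cst|exact: cvg_u]. Qed.

Let cvg_CV : (C m)^-1 @[m --> \oo] --> (1 : R).
Proof. by rewrite -[X in _ --> X]invr1; apply: cvgV => //; exact: cvg_C. Qed.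

Lemma one_sub_atan_gt0 (x : R) : 0 < x -> 0 < 1 - x * atan x^-1.
Proof.
move=> x0; have := @atan_lt R x^-1; rewrite invr_gt0 => /(_ x0).
by rewrite -(ltr_pM2l x0) mulfV ?gt_eqF// subr_gt0.
Qed.

Let C_gt0 m : 0 < C m. Proof. exact: one_sub_atan_gt0. Qed.

Let S_ge0 m : 0 <= S m.
Proof.
apply: mulr_ge0; first by rewrite divr_ge0// ltW.
rewrite subr_ge0 ler_ln ?posrE.
- by rewrite lerDr.
- by rewrite exprn_gt0.
- by rewrite ltr_pwDl ?sqr_ge0.
Qed.

Let w_ge0 m : 0 <= w m. Proof. by rewrite divr_ge0// ltW. Qed.

(** Because [ln (s m) = ln t - L m], one has exactly [N S = t (a + L)]: [a] is the convergent part
    and [L] the divergent one that the centering removes. *)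
Let a (m : nat) : R := 2^-1 * ln (1 + s m ^+ 2) - ln t.

Let cvg_a : a m @[m --> \oo] --> - ln t.
Proof.
have e1 : 1 + s m ^+ 2 @[m --> \oo] --> (1 + 0 * 0 : R).
  apply: cvgD; first exact: cvg_cst.
  by under eq_fun do rewrite expr2; exact: cvgM cvg_s cvg_s.
rewrite mulr0 addr0 in e1.
have e2 : ln (1 + s m ^+ 2) @[m --> \oo] --> (0 : R).
  rewrite -[X in _ --> X](@ln1 R).
  exact: (cvg_comp _ _ e1 (@continuous_ln R 1 ltr01)).
have e3 : 2^-1 * ln (1 + s m ^+ 2) - ln t @[m --> \oo] --> 2^-1 * 0 - ln t.
  by apply: cvgB; [apply: cvgMl_tmp; exact: e2|exact: cvg_cst].
by rewrite mulr0 sub0r in e3.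
Qed.

Let NwE m : (N m)%:R * w m = t * (a m + L m) * (C m)^-1.
Proof.
rewrite /w /S /a.
have -> : ln (s m ^+ 2) = 2 * (ln t - L m).
  by rewrite lnXn// /s ln_div ?posrE// mulr_natl.
rewrite /s; field.
by rewrite !gt_eqF// C_gt0.
Qed.

Let cvg_w : w m @[m --> \oo] --> 0.
Proof.
have c1 : t * (a m / (N m)%:R + L m / (N m)%:R) * (C m)^-1 @[m --> \oo] -->
    t * (- ln t * 0 + 0) * 1.
  apply: cvgM; last exact: cvg_CV.
  by apply: cvgMl_tmp; apply: cvgD; [exact: cvgM cvg_a cvg_NV|exact: cvg_L].
rewrite mulr0 addr0 mulr0 mul0r in c1; apply: cvg_trans c1.
apply: near_eq_cvg; near=> m => /=.
have := NwE m => /(congr1 (fun x => x / (N m)%:R)).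
rewrite mulrAC mulfV ?gt_eqF// mul1r => ->.
by rewrite -mulrDl -!mulrA; congr (_ * (_ * _)); rewrite mulrC.
Unshelve. all: by end_near. Qed.

(** The order of magnitude is [L ^ 2 / N]. This controls both the square root in the modulus and the
    error made when [atan (w m)] is replaced by [w m]. *)
Let cvg_Nw2 : (N m)%:R * w m ^+ 2 @[m --> \oo] --> 0.
Proof.
have c1 : t ^+ 2 * (a m * a m / (N m)%:R + 2 * (a m * (L m / (N m)%:R)) + L m ^+ 2 / (N m)%:R)
      * ((C m)^-1 * (C m)^-1) @[m --> \oo] -->
    t ^+ 2 * (- ln t * - ln t * 0 + 2 * (- ln t * 0) + 0) * (1 * 1).
  apply: cvgM; last by apply: cvgM; exact: cvg_CV.
  apply: cvgMl_tmp; apply: cvgD; last exact: cvg_L2.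
  apply: cvgD; first by apply: cvgM; [exact: cvgM cvg_a cvg_a|exact: cvg_NV].
  by apply: cvgMl_tmp; exact: cvgM cvg_a cvg_L.
rewrite !(mulr0, addr0, mul0r) in c1; apply: cvg_trans c1.
apply: near_eq_cvg; near=> m => /=.
have -> : (N m)%:R * w m ^+ 2 = ((N m)%:R * w m) ^+ 2 / (N m)%:R.
  by field; rewrite gt_eqF.
by rewrite NwE; field; rewrite !gt_eqF// C_gt0.
Unshelve. all: by end_near. Qed.

(** In logarithms, [N ln C] is squeezed between quantities tending to [- t (pi / 2)], and the square
    root contributes at most [N w ^ 2 / 2]. *)
Let cvg_modulus : (C m * Num.sqrt (1 + w m ^+ 2)) ^+ N m @[m --> \oo] --> expR (- (pi / 2) * t).
Proof.
have D_gt0 m : 0 < 1 + w m ^+ 2 by rewrite ltr_pwDl ?sqr_ge0.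
have E m : (C m * Num.sqrt (1 + w m ^+ 2)) ^+ N m =
    expR ((N m)%:R * ln (C m) + 2^-1 * ((N m)%:R * ln (1 + w m ^+ 2))).
  have -> : Num.sqrt (1 + w m ^+ 2) = expR (2^-1 * ln (1 + w m ^+ 2)).
    apply: (@pexpIrn _ 2); rewrite ?nnegrE ?sqrtr_ge0 ?expR_ge0//.
    by rewrite sqr_sqrtr ?(ltW (D_gt0 m))// -expRM_natl mulrA mulfV// mul1r lnK ?posrE.
  rewrite -[in LHS](lnK (C_gt0 m)) -expRD -expRM_natl; congr expR; ring.
under eq_fun do rewrite E.
suff c1 : (N m)%:R * ln (C m) + 2^-1 * ((N m)%:R * ln (1 + w m ^+ 2)) @[m --> \oo] -->
    - (t * (pi / 2)) + 2^-1 * 0.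
  rewrite mulr0 addr0 in c1; rewrite mulNr [pi / 2 * t]mulrC.
  exact: (cvg_comp _ _ c1 (@continuous_expR R _)).
have u_ge0 m : 0 <= s m * atan (s m)^-1.
  rewrite mulr_ge0 ?(ltW (s_gt0 m))//.
  apply: le_trans (@atan_ge_div R _ _); last by rewrite invr_ge0 ltW.
  by rewrite divr_ge0 ?addr_ge0 ?sqr_ge0// invr_ge0 ltW.
apply: cvgD.
  have c1 : - ((N m)%:R * (s m * atan (s m)^-1) * (C m)^-1) @[m --> \oo] -->
      - (t * (pi / 2) * 1) by apply: cvgN; exact: cvgM cvg_Nu cvg_CV.
  rewrite mulr1 in c1.
  apply: squeeze_cvgr c1 (cvgN cvg_Nu); apply: nearW => m.
  have /ln1B_bounds /andP[l1 l2] : 0 <= s m * atan (s m)^-1 < 1.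
    by rewrite u_ge0/= -subr_gt0; exact: C_gt0.
  have l3 : (N m)%:R * ln (C m) <= - ((N m)%:R * (s m * atan (s m)^-1)).
    by rewrite -mulrN ler_pM2l.
  apply/andP; split; last exact: l3.
  by rewrite -mulrA -mulrN ler_pM2l.
apply: cvgMl_tmp; apply: squeeze_cvgr (cvg_cst 0) cvg_Nw2; apply: nearW => m.
rewrite mulr_ge0 ?ln_ge0 ?lerDl ?sqr_ge0//= ler_pM2l// le_ln1Dx//.
by rewrite (lt_le_trans (ltrN10 _)) ?sqr_ge0.
Qed.

(** With [w] in place of [atan w], the expression is [(t a + t L (1 - C)) / C]. Since [N (1 - C)]
    converges and [L / N] vanishes, the second term disappears and the first gives [- t ln t]. The
    cubic bound on the arctangent costs at most [N w ^ 3]. *)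
Let cvg_phase : (N m)%:R * atan (w m) - t * L m @[m --> \oo] --> - (t * ln t).
Proof.
have c1 : t * a m * (C m)^-1 + t * (((N m)%:R * (s m * atan (s m)^-1)) *
    (L m / (N m)%:R)) * (C m)^-1 @[m --> \oo] -->
    t * - ln t * 1 + t * (t * (pi / 2) * 0) * 1.
  apply: cvgD; first by apply: cvgM; [apply: cvgMl_tmp; exact: cvg_a|exact: cvg_CV].
  apply: cvgM; last exact: cvg_CV.
  by apply: cvgMl_tmp; exact: cvgM cvg_Nu cvg_L.
rewrite !(mulr1, mulr0, addr0) mulrN in c1.
have c2 : (N m)%:R * w m - t * L m @[m --> \oo] --> - (t * ln t).
  apply: cvg_trans c1; apply: near_eq_cvg; near=> m => /=.
  rewrite NwE.
  have -> : t * L m = t * L m * C m * (C m)^-1 by rewrite mulfK ?gt_eqF.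
  rewrite [X in _ = _ - t * L m * X * _]/C.
  by field; rewrite !gt_eqF// C_gt0.
have c3 : (N m)%:R * w m - t * L m - (N m)%:R * w m ^+ 2 * w m @[m --> \oo] -->
    - (t * ln t) - 0 * 0 by apply: cvgB => //; exact: cvgM cvg_Nw2 cvg_w.
rewrite mulr0 subr0 in c3.
apply: squeeze_cvgr c3 c2; apply: nearW => m.
have /andP[l1 l2] := atan_bounds (w_ge0 m).
apply/andP; split; last by rewrite lerD2r ler_pM2l.
rewrite addrAC lerD2r.
rewrite (_ : _ - _ = (N m)%:R * (w m - w m ^+ 3)) ?ler_pM2l//.
by ring.
Unshelve. all: by end_near. Qed.

Lemma cvg_heavy_tail_cf phi :
  (C m * Num.sqrt (1 + w m ^+ 2)) ^+ N m * cos ((N m)%:R * atan (w m) + (phi - t * L m))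
    @[m --> \oo] --> expR (- (pi / 2) * t) * cos (- (t * ln t) + phi).
Proof.
apply: cvgM; first exact: cvg_modulus.
have c1 : (N m)%:R * atan (w m) + (phi - t * L m) @[m --> \oo] --> - (t * ln t) + phi.
  have : (N m)%:R * atan (w m) - t * L m + phi @[m --> \oo] --> - (t * ln t) + phi.
    by apply: cvgD; [exact: cvg_phase|exact: cvg_cst].
  apply: cvg_trans; apply: near_eq_cvg; near=> m => /=; ring.
exact: (cvg_comp _ _ c1 (@continuous_cos R _)).
Unshelve. all: by end_near. Qed.

End central_limit.

(** * Construction of the skewed stable law *)

Section skewed_stable.
Context {R : realType}.
Notation mu := (@lebesgue_measure R).

Let heavy_cos (s : R) : R := 1 - s * atan s^-1.
Let heavy_sin (s : R) : R := s / 2 * (ln (1 + s ^+ 2) - ln (s ^+ 2)).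
Let rho (s : R) : R := heavy_cos s * Num.sqrt (1 + (heavy_sin s / heavy_cos s) ^+ 2).
Let beta (s : R) : R := atan (heavy_sin s / heavy_cos s).
Let theta (s : R) : R := - (s * ln `|s|).

Let chi_pos (m : nat) (t phi : R) : R :=
  rho (t / (m.+1 ^ 4)%:R) ^+ (m.+1 ^ 4) *
  cos ((m.+1 ^ 4)%:R * beta (t / (m.+1 ^ 4)%:R) + (phi - t * ln (m.+1 ^ 4)%:R)).

(** The heavy-tail formula is for positive frequencies. Evenness of the cosine gives the negative
    ones with reversed phase, and frequency 0 is set apart because the formula would involve the
    inverse and logarithm of 0. *)
Let chi (m : nat) (t phi : R) : R :=
  if 0 < t then chi_pos m t phi else if t < 0 then chi_pos m (- t) (- phi) else cos phi.

Let chiE m : exists d (T : measurableType d) (P : probability T R) (Y : T -> R),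
  measurable_fun setT Y /\ forall t phi, \int[P]_w cos (t * Y w + phi) = chi m t phi.
Proof.
have [d [T [P [J [mJ JE]]]]] := @exists_heavy_tail R.
set N := (m.+1 ^ 4)%N; have N0 : 0 < N%:R :> R by rewrite ltr0n expn_gt0.
have [d' [T' [P' [Z [mZ ZE]]]]] := exists_iid P N mJ.
pose Y w := N%:R^-1 * (\sum_(i < N) Z i w) - ln N%:R.
have mY : measurable_fun setT Y.
  apply: measurable_funB; last exact: measurable_cst.
  by apply: measurable_funM => //; apply: measurable_sum.
have pos t phi : 0 < t -> \int[P']_w cos (t * Y w + phi) = chi_pos m t phi.
  move=> t0; have := ZE (fun=> t / N%:R) (fun=> rho (t / N%:R)) (fun=> beta (t / N%:R)).
  have sN : 0 < t / N%:R by rewrite divr_gt0.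
  move=> /(_ _ (phi - t * ln N%:R)); rewrite prodr_const sumr_const card_ord => H.
  rewrite /chi_pos -/N mulr_natl -H; last first.
    move=> i psi; rewrite (JE _ _ sN) polar_form//.
    exact: one_sub_atan_gt0.
  apply: eq_Rintegral => w _; congr cos.
  by rewrite /Y mulrBr mulrA addrAC -mulr_sumr -addrA.
exists d', T', P', Y; split => // t phi; rewrite /chi.
case: ifPn => [|t0]; first exact: pos.
case: ifPn => [tN|tN].
  rewrite -pos ?oppr_gt0//; apply: eq_Rintegral => w _.
  by rewrite mulNr -opprD cosN.
have -> : t = 0 by apply/eqP; rewrite eq_le !leNgt t0 tN.
under eq_Rintegral do rewrite mul0r add0r.
exact: Rintegral_cst_probability.
Qed.

Let chi_cvg t phi :
  chi m t phi @[m --> \oo] --> expR (- (pi / 2) * `|t|) * cos (theta t + phi).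
Proof.
rewrite /chi /theta; have [t0|t0|<-] := ltgtP 0 t.
- by rewrite gtr0_norm//; exact: cvg_heavy_tail_cf.
- have tN : 0 < - t by rewrite oppr_gt0.
  rewrite ltr0_norm// -cosN.
  rewrite (_ : - (- (t * ln (- t)) + phi) = - (- t * ln (- t)) + - phi); last by ring.
  exact: cvg_heavy_tail_cf.
- rewrite normr0 mulr0 expR0 mul1r mul0r oppr0 add0r.
  exact: cvg_cst.
Qed.

Let mtheta : measurable_fun setT theta.
Proof. by measurability. Qed.

Let ctheta s : 0 < s -> {for s, continuous theta}.
Proof.
move=> s0; apply: cvgN; apply: cvgM; first exact: cvg_id.
have e1 : `|x| @[x --> s] --> `|s| by exact: norm_continuous.
by apply: (cvg_comp _ _ e1); apply: continuous_ln; rewrite normr_gt0 gt_eqF.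
Qed.

Let theta0 : theta m.+1%:R^-1 @[m --> \oo] --> 0.
Proof.
have h0 m : 0 < (m.+1%:R^-1 : R) by rewrite invr_gt0.
(* With [h = 1 / (m + 1)], the bound [ln (x ^ 2) <= 2 x] at [x = 1 / sqrt h] gives
   [h ln (1 / h) <= 2 sqrt h]. *)
have c1 : 2 * Num.sqrt (m.+1%:R^-1) @[m --> \oo] --> 2 * Num.sqrt (0 : R).
  apply: cvgMl_tmp.
  exact: (cvg_comp _ _ (@cvg_harmonic R) (@sqrt_continuous R 0)).
rewrite sqrtr0 mulr0 in c1.
apply: squeeze_cvgr (cvg_cst 0) c1; apply: nearW => m.
set h : R := m.+1%:R^-1; have hp : 0 < h by exact: h0.
have sh : 0 < Num.sqrt h by rewrite sqrtr_gt0.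
rewrite /theta gtr0_norm// -mulrN -lnV ?posrE// invrK.
apply/andP; split; first by rewrite mulr_ge0 ?(ltW hp)// ln_ge0// ler1n.
have := @lnX_le R (Num.sqrt h)^-1 2; rewrite invr_gt0 => /(_ sh).
rewrite exprVn sqr_sqrtr ?(ltW hp)// invrK => H.
apply: (le_trans (ler_wpM2l (ltW hp) H)).
rewrite -{1}(sqr_sqrtr (ltW hp)) mulrCA expr2 mulfK//.
by rewrite gt_eqF.
Qed.

Lemma exists_skewed_stable : exists L : probability (measurableTypeR R) R,
  forall s phi, \int[L]_x cos (s * x + phi) =
    expR (- (pi / 2) * `|s|) * cos (- (s * ln `|s|) + phi).
Proof.
have c0 : 0 < (pi : R) / 2 by rewrite divr_gt0// pi_gt0.
have [E EE] := exists_exponential c0.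
have q0 x : 0 <= inverse_density (pi / 2) theta E x.
  rewrite mulr_ge0//; first by rewrite invr_ge0 mulr_ge0 ?pi_ge0// ltW.
  exact: (phase_ge0 c0 mtheta chiE chi_cvg EE).
have [L LE] := exists_law_of_phase c0 mtheta EE q0 ctheta theta0.
exists L => s phi; have [s0|s0|<-] := ltgtP 0 s.
- by rewrite LE// /theta gtr0_norm.
- have sN : 0 < - s by rewrite oppr_gt0.
  transitivity (\int[L]_x cos (- s * x + - phi)).
    by apply: eq_Rintegral => x _; rewrite mulNr -opprD cosN.
  rewrite LE// /theta normrN ltr0_norm// -[in RHS]cosN; congr (_ * cos _).
  by ring.
- under eq_Rintegral do rewrite mul0r add0r.
  by rewrite Rintegral_cst_probability normr0 mulr0 expR0 mul1r mul0r oppr0 add0r.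
Qed.

End skewed_stable.

(** * Recognizing the Cauchy law *)

Section cauchy_uniqueness.
Context {R : realType}.
Notation mu := (@lebesgue_measure R).
Local Notation K := poisson_kernel.

Lemma cauchy_prob_ray (a : R) :
  (cauchy_prob `]a, +oo[%classic = (pi^-1 * (pi / 2 - atan a))%:E)%E.
Proof.
rewrite /cauchy_prob integral_itv_obnd_cbnd; last first.
  by apply/measurable_EFinP/measurable_funTS; exact: measurable_cauchy_pdf.
transitivity (\int[mu]_(x in `[a, +oo[) (pi^-1%:E * (K 1 (x - 0))%:E))%E.
  apply: eq_integral => x _; rewrite -EFinM /cauchy_pdf /K subr0 expr1n.
  by rewrite div1r.
rewrite ge0_integralZl//.
- by rewrite integral_poisson_kernel_tail// subr0 divr1 -EFinM.
- apply/measurable_EFinP/measurable_funTS.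
  exact: (continuous_measurable_fun (@continuous_poisson_kernel R 1 ltr01 0)).
- by move=> x _; rewrite lee_fin poisson_kernel_ge0.
- by rewrite lee_fin invr_ge0 pi_ge0.
Qed.

Lemma cauchy_of_rays (m : probability R R) :
  (forall a : R, m `]a, +oo[%classic = cauchy_prob `]a, +oo[%classic) ->
  forall A : set R, measurable A -> m A = cauchy_prob A.
Proof.
move=> mray A mA.
apply: (@measure_unique _ R R (@RGenOInfty.G R) (fun k => `]- k%:R, +oo[%classic)) => //.
- exact: RGenOInfty.measurableE.
- move=> _ _ [x ->] [y ->]; exists (Order.max x y).
  by apply/seteqP; split => z /=; rewrite !in_itv/= !andbT gt_max => /andP.
- by move=> k; exists (- k%:R).
- rewrite -subTset => x _.
  exists (Num.truncn `|x|).+1 => //=; rewrite in_itv/= andbT ltrNl.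
  by rewrite (le_lt_trans (ler_norm _))// normrN truncnS_gt.
- by move=> _ [a ->]; exact: mray.
- by move=> k; rewrite (le_lt_trans (probability_le1 _ _)) ?ltry.
Qed.

Variables (d : measure_display) (T : measurableType d) (P : probability T R).
Variable X : T -> R.
Hypothesis mX : measurable_fun setT X.
Hypothesis cfX : forall s phi, \int[P]_w cos (s * X w + phi) = expR (- `|s|) * cos phi.

(* Averaging the characteristic function over an exponential parameter gives the mean of
   a Poisson kernel; integrating that kernel over a ray and letting [e] tend to [0]
   recovers the distribution function without a general inversion theorem. *)
Lemma poisson_smoothing (e y : R) : 0 < e ->
  \int[P]_w K e (X w - y) = K (1 + e) y.
Proof.
move=> e0; have [E EE] := exists_exponential e0.
have e1 : 0 < 1 + e by rewrite ltr_wpDl.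
have bf (z : T * R) : `|cos (z.2 * X z.1 + - z.2 * y)| <= 1 by exact: cos_max.
have mf : measurable_fun setT (fun z : T * measurableTypeR R =>
  cos (z.2 * X z.1 + - z.2 * y)) by measurability.
have := @Rintegral_fubini R _ _ T (measurableTypeR R) P E _ 1 mf bf.
have -> : \int[P]_x \int[E]_t cos (t * X x + - t * y) = e * \int[P]_w K e (X w - y).
  rewrite -RintegralZl//.
    apply: eq_Rintegral => w _.
    transitivity (\int[E]_t cos ((X w - y) * t + 0)).
      by apply: eq_Rintegral => t _; congr cos; ring.
    by rewrite (exponential_cos _ _ e0 EE) cos0 sin0 mulr0 subr0 mulr1 mulrA.
  apply: (@bounded_integrable _ _ _ _ _ e^-1); last by move=> w; exact: poisson_kernel_le.
  exact: (measurableT_comp (continuous_measurable_fun (@continuous_poisson_kernel R e e0 y)) mX).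
under [RHS]eq_Rintegral do rewrite /= cfX.
rewrite (EE _ 1); last 2 first.
- by measurability.
- move=> t; rewrite normrM mulr_ile1 ?normr_ge0 ?cos_max// ger0_norm ?expR_ge0//.
rewrite (_ : \int[mu]_(t in _) _ =
    \int[mu]_(t in `[0, +oo[) (e * (expR (- (1 + e) * t) * cos (- y * t + 0)))); last first.
  apply: eq_Rintegral => t; rewrite inE/= in_itv/= andbT => t0.
  rewrite (ger0_norm t0) (_ : - (1 + e) * t = - t + - e * t) ?expRD; last by ring.
  by rewrite (_ : - y * t + 0 = - t * y); [ring|ring].
rewrite RintegralZl//; last first.
  apply: le_integrable (integrable_expRN e1) => //.
    by apply/measurable_EFinP/measurable_funTS; measurability.
  by move=> t _ /=; rewrite lee_fin normrM ler_piMr// cos_max.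
rewrite integral_expR_cos// cos0 sin0 mulr0 subr0 mulr1 sqrrN => /mulfI.
by apply; rewrite gt_eqF.
Qed.

(** Integrate [poisson_smoothing] over [y >= a]. By Tonelli the ray integral may be taken first, and
    it is an arctangent on both sides. *)
Lemma smoothed_ray (e a : R) : 0 < e ->
  \int[P]_w (pi / 2 - atan ((a - X w) / e)) = pi / 2 - atan (a / (1 + e)).
Proof.
move=> e0; have e1 : 0 < 1 + e by rewrite ltr_wpDl.
pose f (z : T * measurableTypeR R) : \bar R :=
  ((K e (X z.1 - z.2)) * \1_(`[a, +oo[%classic) z.2)%:E.
have f0 z : (0 <= f z)%E by rewrite lee_fin mulr_ge0 ?poisson_kernel_ge0.
have mf : measurable_fun setT f.
  apply/measurable_EFinP/measurable_funM.
    have mK := continuous_measurable_fun (@continuous_poisson_kernel R e e0 0).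
    have mXY : measurable_fun setT (fun z : T * measurableTypeR R => X z.1 - z.2).
      by measurability.
    have := measurableT_comp mK mXY.
    by apply: eq_measurable_fun => z _ /=; rewrite subr0.
  apply: measurableT_comp; last exact: measurable_snd.
  exact: measurable_indic.
have := @fubini_tonelli _ _ T (measurableTypeR R) R P mu f mf f0.
have -> : (\int[P]_x \int[mu]_y f (x, y) =
    \int[P]_w (pi / 2 - atan ((a - X w) / e))%:E)%E.
  apply: eq_integral => w _; rewrite -(integral_poisson_kernel_tail e0).
  rewrite [RHS]integral_mkcond; apply: eq_integral => y _.
  rewrite /f patchE indicE; case: ifP => _; rewrite ?mulr1 ?mulr0//=.
  by rewrite -poisson_kernelN opprB.
have -> : (\int[mu]_y \int[P]_x f (x, y) = (pi / 2 - atan (a / (1 + e)))%:E)%E.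
  have := @integral_poisson_kernel_tail R _ e1 0 a; rewrite subr0 => <-.
  rewrite [RHS]integral_mkcond; apply: eq_integral => y _.
  rewrite /f /= patchE indicE; case: ifP => _.
    under eq_integral do rewrite mulr1.
    rewrite EFin_Rintegral ?poisson_smoothing ?subr0//.
    apply: (@bounded_integrable _ _ _ _ _ e^-1); last by move=> w; exact: poisson_kernel_le.
    exact: (measurableT_comp (continuous_measurable_fun (@continuous_poisson_kernel R e e0 y)) mX).
  by under eq_integral do rewrite mulr0; rewrite integral0.
by move=> H; rewrite /Rintegral H.
Qed.

Let ray (a : R) (w : T) : R := \1_(X @^-1` `]a, +oo[%classic) w.
Let cray (a : R) (w : T) : R := \1_(X @^-1` `[a, +oo[%classic) w.

Let rayE a w : ray a w = (a < X w)%R%:R.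
Proof. by rewrite /ray indicE; congr ((nat_of_bool _)%:R); apply/idP/idP; rewrite inE/= in_itv/= andbT. Qed.

Let crayE a w : cray a w = (a <= X w)%R%:R.
Proof. by rewrite /cray indicE; congr ((nat_of_bool _)%:R); apply/idP/idP; rewrite inE/= in_itv/= andbT. Qed.

Let mrayset (b : bool) (a : R) : measurable (X @^-1` [set` Interval (BSide b a) +oo%O]).
Proof. by rewrite -[X in measurable X]setTI; exact: mX. Qed.

Let mray a : measurable_fun setT (ray a).
Proof. exact: measurable_indic. Qed.

Let mcray a : measurable_fun setT (cray a).
Proof. exact: measurable_indic. Qed.

Let iray a : P.-integrable setT (EFin \o ray a).
Proof.
apply: (@bounded_integrable _ _ _ _ _ 1) => // w.
by rewrite rayE ger0_norm// lern1; case: (_ < _).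
Qed.

Let icray a : P.-integrable setT (EFin \o cray a).
Proof.
apply: (@bounded_integrable _ _ _ _ _ 1) => // w.
by rewrite crayE ger0_norm// lern1; case: (_ <= _).
Qed.

(* The limit of the arctangent gives half of its weight to the boundary point. *)
Let cvg_ray a w :
  pi / 2 - atan ((a - X w) / m.+1%:R^-1) @[m --> \oo] --> pi / 2 * (ray a w + cray a w).
Proof.
have cvg_up (b : R) : 0 < b -> atan (b / m.+1%:R^-1) @[m --> \oo] --> (pi : R) / 2.
  move=> b0; have e0 : (m.+1%:R : R) @[m --> \oo] --> +oo%R.
    by rewrite -gtr0_cvgV0; [exact: cvg_harmonic|exact: nearW].
  have eb : b * x @[x --> +oo%R] --> +oo%R by exact: gt0_cvgMry b0 cvg_id.
  have e1 := cvg_comp _ _ e0 eb.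
  have e2 := cvg_comp _ _ e1 (@cvgy_atan R).
  by under eq_fun do rewrite invrK; exact: e2.
rewrite rayE crayE; have [lt|lt|eq] := ltgtP (X w) a.
- rewrite addr0 mulr0 -[X in _ --> X](subrr (pi / 2)).
  by apply: cvgB; [exact: cvg_cst|apply: cvg_up; rewrite subr_gt0].
- rewrite (_ : pi / 2 * (1 + 1) = pi / 2 - - (pi / 2)); last by rewrite mulrDr mulr1 opprK.
  apply: cvgB; first exact: cvg_cst.
  under eq_fun do rewrite -opprB mulNr atanN.
  by apply: cvgN; apply: cvg_up; rewrite subr_gt0.
- rewrite add0r mulr1 eq subrr.
  under eq_fun do rewrite mul0r atan0 subr0.
  exact: cvg_cst.
Qed.

(** The limit of [smoothed_ray]. Atoms are not yet excluded, so only the sum of the masses of the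
    open and the closed ray is identified. *)
Let ray_sum a : pi / 2 * (\int[P]_w ray a w + \int[P]_w cray a w) = pi / 2 - atan a.
Proof.
rewrite -RintegralD// -RintegralZl//; last first.
  by apply: eq_integrable (integrableD _ (iray a) (icray a)).
have pi0 : 0 <= (pi : R) := pi_ge0 R.
have cvL : \int[P]_w (pi / 2 - atan ((a - X w) / m.+1%:R^-1)) @[m --> \oo] -->
    \int[P]_w (pi / 2 * (ray a w + cray a w)).
  apply: (@bounded_cvg _ _ _ _ _ _ pi).
  - move=> m; apply: measurable_funB; first exact: measurable_cst.
    apply: measurableT_comp; first exact: (continuous_measurable_fun (@continuous_atan R)).
    by measurability.
  - by measurability.
  - by move=> w; exact: cvg_ray.
  - move=> m w; rewrite ler_norml.
    have := atan_gtNpi2 ((a - X w) / m.+1%:R^-1).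
    have := atan_ltpi2 ((a - X w) / m.+1%:R^-1).
    by move: (atan _) (pi : R) pi0 => x p p0 xp px; apply/andP; split; lra.
have cvR : pi / 2 - atan (a / (1 + m.+1%:R^-1)) @[m --> \oo] --> (pi : R) / 2 - atan a.
  apply: cvgB; first exact: cvg_cst.
  have e1 : a / (1 + m.+1%:R^-1) @[m --> \oo] --> a / (1 + 0).
    apply: cvgMl_tmp; apply: cvgV; first by rewrite addr0 oner_eq0.
    by apply: cvgD; [exact: cvg_cst|exact: cvg_harmonic].
  rewrite addr0 divr1 in e1.
  exact: (cvg_comp _ _ e1 (@continuous_atan R a)).
have E1 : (fun m : nat => \int[P]_w (pi / 2 - atan ((a - X w) / m.+1%:R^-1))) =
    (fun m : nat => pi / 2 - atan (a / (1 + m.+1%:R^-1))).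
  by apply/funext => m; rewrite smoothed_ray.
by move: cvL; rewrite E1 => cvL; exact: (cvg_unique _ cvL cvR).
Qed.

(** The open ray at [a] has at most half of the sum in [ray_sum]. Conversely it contains every
    closed ray at [b > a], which has at least half of the sum at [b]; let [b] decrease to [a] and
    use continuity of the arctangent. *)
Let Rintegral_ray a : \int[P]_w ray a w = pi^-1 * (pi / 2 - atan a).
Proof.
have pi0 : 0 < (pi : R) := pi_gt0 R.
have ray_le b : \int[P]_w ray b w <= \int[P]_w cray b w.
  apply: le_Rintegral => // w _; rewrite rayE crayE ler_nat.
  by case: (ltP b (X w)) => // /ltW ->.
have cray_le b : a < b -> \int[P]_w cray b w <= \int[P]_w ray a w.
  move=> ab; apply: le_Rintegral => // w _; rewrite rayE crayE ler_nat.
  by case: (leP b (X w)) => // /(lt_le_trans ab) ->.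
apply/eqP; rewrite eq_le; apply/andP; split.
  rewrite ler_pdivlMl// -ray_sum; move: (ray_le a) (pi : R) pi0.
  move: (\int[P]_w _) (\int[P]_w _) => x y xy p p0.
  rewrite mulrDr [leRHS](_ : _ = p * ((x + y) / 2)); last by field.
  by rewrite ler_pM2l//; lra.
have cv : pi^-1 * (pi / 2 - atan (a + m.+1%:R^-1)) @[m --> \oo] -->
    pi^-1 * ((pi : R) / 2 - atan a).
  apply: cvgMl_tmp; apply: cvgB; first exact: cvg_cst.
  have e1 : a + m.+1%:R^-1 @[m --> \oo] --> a + 0.
    by apply: cvgD; [exact: cvg_cst|exact: cvg_harmonic].
  rewrite addr0 in e1.
  exact: (cvg_comp _ _ e1 (@continuous_atan R a)).
rewrite leNgt; apply/negP => lt0.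
have [m _ /(_ m (leqnn m))] : \forall m \near \oo,
    \int[P]_w ray a w < pi^-1 * (pi / 2 - atan (a + m.+1%:R^-1)).
  exact: (cvgr_gt _ cv _ lt0).
set b := a + _ => /=; rewrite ltNge => /negP; apply.
have ab : a < b by rewrite ltrDl invr_gt0.
apply: le_trans (cray_le _ ab).
rewrite ler_pdivrMl// -ray_sum; move: (ray_le b) (pi : R) pi0.
move: (\int[P]_w _) (\int[P]_w _) => x y xy p p0.
rewrite mulrDr [leLHS](_ : _ = p * ((x + y) / 2)); last by field.
by rewrite ler_pM2l//; lra.
Qed.

Lemma cauchy_of_cf (A : set R) : measurable A -> P (X @^-1` A) = cauchy_prob A.
Proof.
pose Y : {RV P >-> R} := mfun_Sub (mem_set mX).
move=> mA; rewrite -[LHS]/(distribution P Y A).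
apply: cauchy_of_rays => // a.
rewrite [RHS]cauchy_prob_ray -Rintegral_ray -EFin_Rintegral// integral_indic// setIT.
by rewrite /distribution.
Qed.

End cauchy_uniqueness.

(** * Existence of centers *)

Section sufficiency.
Context {R : realType}.

Lemma sum_diagonal (n : nat) (i : 'I_n) (F : bool -> R) :
  \sum_(j < n) F (i == j) = F true + (n%:R - 1) * F false.
Proof.
rewrite (bigD1 i)//= eqxx; congr (_ + _).
rewrite (eq_bigr (fun=> F false)) => [|j /negbTE]; last by rewrite eq_sym => ->.
rewrite sumr_const -[_ *+ _]mulr_natl; congr (_ * _).
have : #|predC1 i|.+1 = n by rewrite cardC1 card_ord prednK//; exact: leq_ltn_trans (ltn_ord i).
by move=> /(congr1 (fun m => m%:R : R)); rewrite -natr1 => <-; rewrite addrK.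
Qed.

Let xlnx (x : R) : R := x * ln `|x|.

Let xlnxN x : xlnx (- x) = - xlnx x.
Proof. by rewrite /xlnx normrN mulNr. Qed.

(** The defect of homogeneity is linear in [y], hence acts in a phase as a translation. *)
Let xlnxM (k y : R) : 0 < k -> xlnx (k * y) - k * xlnx y = k * y * ln k.
Proof.
move=> k0; rewrite /xlnx; have [->|y0] := eqVneq y 0.
  by rewrite mulr0 !mul0r mulr0 subrr.
rewrite normrM (gtr0_norm k0) lnM ?posrE ?normr_gt0//.
by ring.
Qed.

Lemma n_center_sufficient (n : nat) (c : R) : (2 <= n)%N ->
  - (ln (n%:R - 1) / pi) <= c <= ln (n%:R - 1) / pi -> n_center (@cauchy_prob R) n c.
Proof.
move=> n2 cL; set k : R := n%:R - 1.
have k1 : 1 <= k by rewrite /k lerBrDr -(natrD _ 1 1) ler_nat.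
have k0 : 0 < k by apply: lt_le_trans k1.
have pi0 : 0 < (pi : R) := pi_gt0 R.
have [L LE] := @exists_skewed_stable R.
have [d [T [P [Z [mZ ZE]]]]] := exists_iid L (n + n) (@measurable_id _ _ setT).
pose l := ln k / pi.
(* The modulus depends on [al + be] and the translation on [al - be]. For [n = 2] one has [l = 0]
   and only [c = 0] is to be reached, a case kept apart because the weights divide by [l]. *)
have [al [be [al0 be0 abE cE]]] : exists al be : R, [/\ 0 <= al, 0 <= be, al + be = 1 &
    c = (al - be) * l].
  have l0 : 0 <= l by rewrite divr_ge0 ?ln_ge0// ltW.
  have [l00|l00] := eqVneq l 0.
    exists 1, 0; split=> //; first by rewrite addr0.
    by move: cL; rewrite -/k -/l l00 oppr0 mulr0 => cL; apply/eqP; rewrite eq_le andbC.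
  have lp : 0 < l by rewrite lt0r l00.
  exists ((l + c) / (2 * l)), ((l - c) / (2 * l)); move: cL; rewrite -/k -/l => /andP[c1 c2].
  have ll : 0 <= 2 * l by apply: mulr_ge0.
  split.
  - by rewrite divr_ge0//; lra.
  - by rewrite divr_ge0// subr_ge0.
  - by field.
  - by field.
(* [W true] is the weight of a variable in the coordinate of its own index, [W false] its
   weight in the [k] others, so that it cancels in the sum of all the coordinates; the
   indices [j >= n] carry the mirrored family. *)
pose W (b : bool) : R := (if b then k else - 1) / (k * pi).
pose a (i : 'I_n) (j : nat) : R :=
  if (j < n)%N then al * W (i == j :> nat) else - be * W (i == j - n :> nat)%N.
have sum_a (i : 'I_n) (F : R -> R) : \sum_(j < n + n) F (a i j) =
    (F (al * W true) + k * F (al * W false)) +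
    (F (- be * W true) + k * F (- be * W false)).
  rewrite big_split_ord/=; congr (_ + _).
    rewrite -[RHS](sum_diagonal i (fun b => F (al * W b))); apply: eq_bigr => j _.
    by rewrite /a ltn_ord.
  rewrite -[RHS](sum_diagonal i (fun b => F (- be * W b))); apply: eq_bigr => j _.
  by rewrite /a ltnNge leq_addr/= addKn.
pose X (i : 'I_n) (w : T) : R := c + \sum_(j < n + n) a i j * Z j w.
have mX i : measurable_fun setT (X i).
  apply: measurable_funD; first exact: measurable_cst.
  by apply: measurable_sum => j; apply: measurable_funM.
have WT : W true = pi^-1 by rewrite /W invfM mulrA mulfV ?mul1r ?gt_eqF.
have WTF : W true = - k * W false.
  by rewrite WT /W invfM mulN1r mulrNN mulrA mulfV ?mul1r ?gt_eqF.
have cfX i s phi : \int[P]_w cos (s * X i w + phi) = expR (- `|s|) * cos phi.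
  have := ZE (fun j => s * a i j) (fun j => expR (- (pi / 2) * `|s * a i j|))
    (fun j => - xlnx (s * a i j)).
  move=> /(_ (fun j => LE (s * a i j)) (s * c + phi)).
  rewrite -expR_sum.
  rewrite (sum_a i (fun x => - (pi / 2) * `|s * x|)) (sum_a i (fun x => - xlnx (s * x))).
  (* The absolute weights [1 / pi] and [k] times [1 / (k pi)] add up to [2 / pi], which the stable
     rate [pi / 2] turns into the Cauchy rate 1. *)
  have -> : - (pi / 2) * `|s * (al * W true)| + k * (- (pi / 2) * `|s * (al * W false)|) +
      (- (pi / 2) * `|s * (- be * W true)| + k * (- (pi / 2) * `|s * (- be * W false)|)) =
      - `|s|.
    have WF : k * `|W false| = `|W true| by rewrite WTF (normrM (- k)) (normrN k) (gtr0_norm k0).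
    have nW x b : `|s * (x * W b)| = `|s| * (`|x| * `|W b|) by rewrite 2!normrM.
    rewrite !nW (normrN be) (ger0_norm al0) (ger0_norm be0).
    rewrite [LHS](_ : _ = - (pi / 2) * `|s| * (al + be) * (`|W true| + k * `|W false|)); last first.
      by move: (pi : R) `|_| `|_| `|_| => p x y z; ring.
    rewrite WF abE WT (@gtr0_norm _ pi^-1) ?invr_gt0// mulr1.
    by move: (pi : R) pi0 => p p0; field; rewrite gt_eqF.
  have -> : - xlnx (s * (al * W true)) + k * - xlnx (s * (al * W false)) +
      (- xlnx (s * (- be * W true)) + k * - xlnx (s * (- be * W false))) = - (s * c).
    have E x : - xlnx (s * (x * W true)) + k * - xlnx (s * (x * W false)) = - (s * x * l).
      (* In terms of [y] the own weight is [k y] and each of the [k] others is [- y]; as [xlnx] is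
         odd, the phases combine into [- (xlnx (k y) - k xlnx y)], with [k y = s x / pi]. *)
      pose y := - (s * (x * W false)).
      have -> : s * (x * W true) = k * y by rewrite /y WTF; ring.
      have -> : s * (x * W false) = - y by rewrite /y opprK.
      rewrite xlnxN opprK.
      have -> : - xlnx (k * y) + k * xlnx y = - (xlnx (k * y) - k * xlnx y) by ring.
      rewrite xlnxM// /y /l.
      have -> : k * - (s * (x * W false)) = s * x * W true by rewrite WTF; ring.
      by rewrite WT; congr (- _); rewrite -!mulrA; congr (_ * (_ * _)); exact: mulrC.
    by rewrite !E cE; ring.
  rewrite addrA addNr add0r => <-; apply: eq_Rintegral => w _; congr cos.
  rewrite (eq_bigr (fun j : 'I__ => s * (a i j * Z j w))) => [|j _]; last by rewrite mulrA.
  by rewrite -mulr_sumr /X; ring.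
exists d, T, P, (fun i => mfun_Sub (mem_set (mX i))); split.
  by move=> i A mA; exact: (cauchy_of_cf (mX i) (cfX i)).
apply: aeW => w; rewrite /= /X big_split/= sumr_const card_ord -[_ *+ n]mulr_natl.
rewrite exchange_big/= big1 ?addr0// => j _; rewrite -mulr_suml.
rewrite [X in X * _](_ : _ = 0) ?mul0r//.
(* For a fixed variable [j], its weights over all coordinates are one [W true] and [k] times
   [W false], so the sum vanishes at every point and not just almost surely. *)
have W0 x : x * W true + (n%:R - 1) * (x * W false) = 0.
  by rewrite WTF -/k; ring.
have [jn|nj] := ltnP j n.
  rewrite -[RHS](W0 al) -(sum_diagonal (Ordinal jn) (fun b => al * W b)).
  by apply: eq_bigr => i _; rewrite /a jn eq_sym.
have jn : (j - n < n)%N by rewrite ltn_subLR.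
rewrite -[RHS](W0 (- be)) -(sum_diagonal (Ordinal jn) (fun b => - be * W b)).
by apply: eq_bigr => i _; rewrite /a ltnNge nj/= eq_sym.
Qed.

End sufficiency.

(** * The bound on centers *)

Section necessity.
Context {R : realType}.
Notation mu := (@lebesgue_measure R).

Lemma atanV (x : R) : 0 < x -> atan x^-1 = pi / 2 - atan x.
Proof.
move=> x0; have a0 : 0 < atan x by rewrite -(@atan0 R) lt_atan.
have a1 := atan_ltpi2 x.
rewrite -[RHS]tanK; last first.
  by rewrite in_itv/=; move: (atan x) (pi : R) a0 a1 => y p y0 yp; apply/andP; split; lra.
congr atan; rewrite /tan -opprB sinN cosN sinBpihalf cosBpihalf opprK.
by rewrite -[in LHS](@atanK R x) /tan invf_div.
Qed.

Lemma cauchy_prob_cray (a : R) :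
  (cauchy_prob `[a, +oo[%classic = (pi^-1 * (pi / 2 - atan a))%:E)%E.
Proof.
rewrite -cauchy_prob_ray /cauchy_prob integral_itv_obnd_cbnd//.
by apply/measurable_EFinP/measurable_funTS; exact: measurable_cauchy_pdf.
Qed.

Lemma cauchy_probN (A : set R) : measurable A ->
  cauchy_prob (-%R @^-1` A) = cauchy_prob A.
Proof.
have mN : measurable_fun [set: R] (-%R : R -> R) by exact: (@measurable_funN _ _ _ _ id).
pose Y : {RV (@cauchy_prob R) >-> R} := mfun_Sub (mem_set mN).
move=> mA; rewrite -[LHS]/(distribution (@cauchy_prob R) Y A).
apply: cauchy_of_rays => // a.
rewrite [RHS]cauchy_prob_ray /distribution /pushforward/=.
rewrite [X in cauchy_prob X](_ : _ = ~` `[- a, +oo[%classic); last first.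
  apply/seteqP; split => x /=; rewrite !in_itv/= !andbT ltrNr.
    by rewrite ltNge => /negP.
  by move/negP; rewrite -ltNge.
rewrite probability_setC//.
rewrite [X in (_ - X)%E](cauchy_prob_cray (- a)) -EFinB atanN; congr EFin.
by have := @pi_gt0 R; move: (pi : R) (atan a) => p y p0; field; rewrite gt_eqF.
Qed.

(* [R] and [measurableTypeR R] carry different displays, so the density formula for
   Lebesgue measure is transported along the identity random variable. *)
Lemma integral_cauchy (f : R -> \bar R) : measurable_fun setT f ->
  (forall x, 0 <= f x)%E ->
  (\int[@cauchy_prob R]_x f x = \int[mu]_x (f x * (cauchy_pdf x)%:E))%E.
Proof.
move=> mf f0.
have [P PE] := @exists_density_probability R _ (measurableTypeR R) mu _
  measurable_cauchy_pdf cauchy_pdf_ge0 integral_cauchy_pdf.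
have mX : @measurable_fun _ _ (measurableTypeR R) R setT (fun x : R => x).
  exact: measurable_id.
pose X : {RV P >-> R} := @mfun_Sub _ _ (measurableTypeR R) R _ (mem_set mX).
transitivity (\int[distribution P X]_x f x)%E.
  by apply: eq_measure_integral => A mA _; rewrite -[RHS]/(P A) PE.
rewrite ge0_integral_distribution//.
exact: (@ge0_integral_density R _ (measurableTypeR R) _ _ _
  measurable_cauchy_pdf cauchy_pdf_ge0 PE _ mf f0).
Qed.

(* For [k = n - 1], the truncation [g] below satisfies [sum_i g (x_i) >= n (c + a)]
   whenever [sum_i x_i = n c]: either every [x_i] is at most [k a], and [g x >= x + a],
   or some [x_i > k a] contributes [n (c + a)] on its own. *)
Lemma n_center_truncation (n : nat) (c a k : R) : (2 <= n)%N -> 0 <= c -> 0 < a ->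
  k = n%:R - 1 ->
  n_center (@cauchy_prob R) n c ->
  c + a <= (2 * pi)^-1 * (ln (1 + (k * a) ^+ 2) - ln (1 + a ^+ 2)) +
    a / pi * (atan (k * a) + atan a) +
    n%:R * (c + a) * (pi^-1 * (pi / 2 - atan (k * a))).
Proof.
move=> n2 c0 a0 kE [d [T [P [X [XE XS]]]]].
have k1 : 1 <= k by rewrite kE lerBrDr -(natrD _ 1 1) ler_nat.
have k0 : 0 < k by apply: lt_le_trans k1.
have ka0 : 0 < k * a by rewrite mulr_gt0.
have n0 : 0 < n%:R :> R by rewrite ltr0n; exact: leq_trans n2.
have nca : 0 <= n%:R * (c + a) by rewrite mulr_ge0 ?addr_ge0// ltW.
pose g (x : R) : R := (x + a) * \1_(`[- a, k * a]%classic) x +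
  n%:R * (c + a) * \1_(`]k * a, +oo[%classic) x.
have g1_ge0 x : 0 <= (x + a) * \1_(`[- a, k * a]%classic) x.
  rewrite indicE; case: (boolP (_ \in _)); rewrite ?mulr0// mulr1.
  by rewrite inE/= in_itv/= => /andP[xa _]; rewrite -lerBlDr sub0r.
have g2_ge0 x : 0 <= n%:R * (c + a) * \1_(`]k * a, +oo[%classic) x.
  by rewrite mulr_ge0// indicE.
have g0 x : 0 <= g x by rewrite addr_ge0.
have mg1 : measurable_fun setT (fun x : R => (x + a) * \1_(`[- a, k * a]%classic) x).
  apply: measurable_funM; last exact: measurable_indic.
  by measurability.
have mg2 : measurable_fun setT (fun x : R => n%:R * (c + a) * \1_(`]k * a, +oo[%classic) x).
  by apply: measurable_funM; [exact: measurable_cst|exact: measurable_indic].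
have mg : measurable_fun setT g by exact: measurable_funD.
have gx x : x <= k * a -> x + a <= g x.
  move=> xk; rewrite /g indicE; case: (boolP (_ \in _)) => [_|].
    by rewrite mulr1 lerDl.
  rewrite mulr0 add0r => /negP xa; apply: le_trans (g2_ge0 x).
  rewrite -lerBrDr sub0r leNgt; apply/negP => ax; apply: xa.
  by rewrite inE/= in_itv/= xk ltW.
have gb x : k * a < x -> n%:R * (c + a) <= g x.
  move=> xk; rewrite /g [X in _ + _ * X]indicE mem_set/= ?in_itv/= ?xk// mulr1.
  by rewrite lerDr.
have gS (x : 'I_n -> R) : \sum_(i < n) x i = n%:R * c -> n%:R * (c + a) <= \sum_(i < n) g (x i).
  move=> xS; have [[i xi]|H] := pselect (exists i, k * a < x i).
    by rewrite (bigD1 i)//= (le_trans (gb _ xi))// lerDl sumr_ge0.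
  rewrite mulrDr -xS [n%:R * a]mulr_natl -[X in _ *+ X](card_ord n) -sumr_const -big_split/=.
  apply: ler_sum => i _; apply: gx; rewrite leNgt; apply/negP => xi; apply: H.
  by exists i.
have Eg i : (\int[P]_w (g (X i w))%:E = \int[@cauchy_prob R]_x (g x)%:E)%E.
  rewrite -(@ge0_integral_distribution _ _ _ _ _ P (X i) (EFin \o g)).
  - by apply: eq_measure_integral => A mA _; exact: XE.
  - exact/measurable_EFinP.
  - by move=> x; rewrite lee_fin.
have H : (n%:R%:E * (c + a)%:E <= n%:R%:E * \int[@cauchy_prob R]_x (g x)%:E)%E.
  apply: (@le_trans _ _ (\int[P]_w (\sum_(i < n) g (X i w))%:E)%E).
    have -> : (n%:R%:E * (c + a)%:E = \int[P]_w (n%:R * (c + a))%:E)%E.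
      by rewrite integral_cst//= probability_setT mule1.
    apply: ae_ge0_le_integral => //.
    - by move=> w _; rewrite lee_fin sumr_ge0.
    - by apply/measurable_EFinP; apply: measurable_sum => i; exact: measurableT_comp.
    - by apply: filterS XS => w XSw _; rewrite lee_fin; exact: gS.
  under eq_integral do rewrite -sumEFin.
  rewrite ge0_integral_sum//.
  - under eq_bigr do rewrite Eg.
    by rewrite sumr_const card_ord mule_natl.
  - by move=> i; apply/measurable_EFinP; exact: measurableT_comp.
  - by move=> i w _; rewrite lee_fin.
move: H; rewrite lee_pmul2l// => H; rewrite -lee_fin (le_trans H)//.
under eq_integral do rewrite /g EFinD.
rewrite ge0_integralD//=; last 4 first.
- by move=> x _; rewrite lee_fin.
- exact/measurable_EFinP.
- by move=> x _; rewrite lee_fin.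
- exact/measurable_EFinP.
have -> : (\int[@cauchy_prob R]_x (n%:R * (c + a) * \1_(`]k * a, +oo[%classic) x)%:E =
    (n%:R * (c + a) * (pi^-1 * (pi / 2 - atan (k * a))))%:E)%E.
  under eq_integral do rewrite EFinM.
  rewrite ge0_integralZl//=.
  - by rewrite integral_indic// setIT [X in (_ * X)%E](cauchy_prob_ray (k * a)).
  - exact/measurable_EFinP/measurable_indic.
rewrite EFinD leeD2r//.
rewrite integral_cauchy//; first last.
  exact/measurable_EFinP.
have cf : continuous (fun x : R => (x + a) * cauchy_pdf x).
  move=> x; apply: cvgM; last exact: continuous_cauchy_pdf.
  by apply: cvgD; [exact: cvg_id|exact: cvg_cst].
have ak : - a <= k * a by rewrite (le_trans _ (ltW ka0))// oppr_le0 ltW.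
have dF : antiderivative (fun x : R => (x + a) * cauchy_pdf x)
    (fun x => (2 * pi)^-1 * ln (1 + x ^+ 2) + a / pi * atan x).
  move=> x; have x0 : 0 < 1 + x ^+ 2 by rewrite ltr_pwDl ?sqr_ge0.
  have dq : is_derive x 1 (fun y : R => 1 + y ^+ 2) (2 * x).
    by apply: is_derive_eq; rewrite /GRing.scale /=; ring.
  have dl : is_derive x 1 (fun y : R => ln (1 + y ^+ 2)) ((1 + x ^+ 2)^-1 * (2 * x)).
    exact: (@is_derive1_comp _ (@ln R) _ x _ _ (is_derive1_ln x0) dq).
  apply: is_derive_eq; rewrite /GRing.scale /= /cauchy_pdf.
  have := @pi_gt0 R; move: (pi : R) => p p0.
  by field; rewrite !gt_eqF.
have -> : (\int[mu]_x (((x + a) * \1_(`[(- a)%R, (k * a)%R]%classic) x)%:E * (cauchy_pdf x)%:E) =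
    \int[mu]_(x in `[(- a)%R, (k * a)%R]) ((x + a) * cauchy_pdf x)%:E)%E.
  rewrite [RHS]integral_mkcond; apply: eq_integral => x _.
  by rewrite patchE indicE -EFinM; case: ifP => _; rewrite ?mulr1// mulr0 mul0r.
rewrite EFin_Rintegral//; last first.
  apply: continuous_compact_integrable; first exact: segment_compact.
  exact: continuous_subspaceT.
rewrite (FTC2 ak cf dF) lee_fin sqrrN atanN le_eqVlt; apply/orP; left; apply/eqP.
have := @pi_gt0 R; move: (pi : R) => p p0.
by field; rewrite gt_eqF.
Qed.

(* The bound of [n_center_truncation] exceeds [ln k / pi] by [O(1 / a)] only. *)
Lemma n_center_le (n : nat) (c : R) : (2 <= n)%N ->
  n_center (@cauchy_prob R) n c -> c <= ln (n%:R - 1) / pi.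
Proof.
move=> n2 nc; pose k : R := n%:R - 1.
have k1 : 1 <= k by rewrite /k lerBrDr -(natrD _ 1 1) ler_nat.
have k0 : 0 < k by apply: lt_le_trans k1.
have pi0 : 0 < (pi : R) := pi_gt0 R.
have l0 : 0 <= ln k / pi by rewrite divr_ge0 ?ln_ge0// ltW.
rewrite leNgt; apply/negP => lc; rewrite -/k in lc.
have c0 : 0 <= c by apply: le_trans (ltW lc).
(* The 1 comes from [1 - a ^ 2 / (1 + a ^ 2) <= 1 / a], the other term from [n c] times the tail
   bound [1 / (k a)]. *)
pose M : R := pi^-1 * (1 + n%:R * c / k).
have M0 : 0 < M by rewrite mulr_gt0 ?invr_gt0// ltr_pwDl ?divr_ge0 ?mulr_ge0// ltW.
have bound a : 0 < a -> c - ln k / pi <= M / a.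
  move=> a0; have ka0 : 0 < k * a by rewrite mulr_gt0.
  have := n_center_truncation n2 c0 a0 (erefl k) nc.
  have A1 : a / (1 + a ^+ 2) <= pi / 2 - atan a.
    rewrite -atanV//.
    have -> : a / (1 + a ^+ 2) = a^-1 / (1 + a^-1 ^+ 2).
      by field; rewrite !gt_eqF//= ?addr_gt0 ?exprn_gt0.
    by apply: atan_ge_div; rewrite invr_ge0 ltW.
  have A2 : pi / 2 - atan (k * a) <= (k * a)^-1.
    by rewrite -atanV//; apply/ltW/atan_lt; rewrite invr_gt0.
  have A3 : ln (1 + (k * a) ^+ 2) - ln (1 + a ^+ 2) <= 2 * ln k.
    have a2 : 0 < 1 + a ^+ 2 by rewrite ltr_pwDl ?sqr_ge0.
    rewrite lerBlDr mulr_natl -lnXn// -lnM ?posrE ?exprn_gt0// ler_ln ?posrE.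
    - by rewrite mulrDr mulr1 exprMn lerD2r expr_ge1// ltW.
    - by rewrite ltr_pwDl ?sqr_ge0.
    - by rewrite mulr_gt0 ?exprn_gt0.
  move: A1 A2 A3.
  set D := ln _ - ln _; set u := pi / 2 - atan a; set v := pi / 2 - atan (k * a).
  move=> A1 A2 A3 H.
  have nk : n%:R = k + 1 by rewrite /k subrK.
  (* Rewriting with the complements [u] and [v] shows the cancellation: [a u] and [k a v] both tend
     to 1, so [- a u + k a v] is only of order [1 / a]. *)
  have H2 : pi * c <= D / 2 - a * u + (k * a + n%:R * c) * v.
    have -> : pi * c = pi * (c + a) - pi * a by ring.
    rewrite lerBlDr; apply: (le_trans (ler_wpM2l (ltW pi0) H)).
    rewrite le_eqVlt; apply/orP; left; apply/eqP.
    have -> : atan a = pi / 2 - u by rewrite /u opprB addrC subrK.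
    have -> : atan (k * a) = pi / 2 - v by rewrite /v opprB addrC subrK.
    rewrite nk; move: (pi : R) pi0 (u) (v) (D) => p p0 u1 v1 D1.
    by field; rewrite gt_eqF.
  have B1 : a * (a / (1 + a ^+ 2)) <= a * u by rewrite ler_pM2l.
  have B2 : (k * a + n%:R * c) * v <= (k * a + n%:R * c) * (k * a)^-1.
    by rewrite ler_wpM2l// addr_ge0 ?mulr_ge0// ltW.
  have B3 : 1 - a * (a / (1 + a ^+ 2)) <= a^-1.
    have a2 : 0 < 1 + a ^+ 2 by rewrite ltr_pwDl ?sqr_ge0.
    have -> : 1 - a * (a / (1 + a ^+ 2)) = (1 + a ^+ 2)^-1 by field; rewrite gt_eqF.
    by rewrite lef_pV2 ?posrE//; nra.
  have B4 : (k * a + n%:R * c) * (k * a)^-1 = 1 + n%:R * c / k / a.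
    by field; rewrite !gt_eqF.
  have B5 : pi * c <= ln k + (1 + n%:R * c / k) / a.
    have -> : (1 + n%:R * c / k) / a = a^-1 + n%:R * c / k / a by ring.
    move: B4 B3 B2 B1 H2; move: (_ * u) (_ * v) (a * _) (_ / k / a) ((_ + _) / _).
    by move=> x1 x2 x3 x4 x5 *; lra.
  rewrite lerBlDr -(ler_pM2l pi0) (le_trans B5)// mulrDr [pi * (ln k / pi)]mulrC mulfVK ?gt_eqF//.
  by rewrite addrC lerD2r /M !mulrA mulfV ?mul1r ?gt_eqF.
have d0 : 0 < c - ln k / pi by rewrite subr_gt0.
(* At this value of [a] the bound [M / a] is half of the supposed gap, a contradiction. *)
have M2 : 0 < 2 * M / (c - ln k / pi) by rewrite divr_gt0// mulr_gt0.
have := bound _ M2; set dl := c - _.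
have -> : M / (2 * M / dl) = dl / 2 by field; rewrite !gt_eqF.
by rewrite leNgt -/dl => /negP; apply; rewrite ltr_pdivrMr// ltr_pMr// ltr1n.
Qed.

Lemma n_center_opp (n : nat) (c : R) :
  n_center (@cauchy_prob R) n c -> n_center (@cauchy_prob R) n (- c).
Proof.
move=> [d [T [P [X [XE XS]]]]].
have mN i : measurable_fun setT (fun w => - X i w) by exact: measurable_funN.
exists d, T, P, (fun i => mfun_Sub (mem_set (mN i))); split.
  move=> i A mA; rewrite -[RHS]cauchy_probN// -(XE i)//.
  rewrite -[X in measurable X]setTI.
  exact: (@measurable_funN _ _ _ _ id).
by apply: filterS XS => w; rewrite /= sumrN mulrN => ->.
Qed.

End necessity.

Theorem theorem4p2 (R : realType) (n : nat) (hn : (2 <= n)%N) :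
  [set c : R | n_center (@cauchy_prob R) n c] =
  `[- (ln (n%:R - 1) / pi), ln (n%:R - 1) / pi]%classic.
Proof.
apply/seteqP; split => c /=; rewrite in_itv/=; last exact: n_center_sufficient.
move=> nc; apply/andP; split; last exact: n_center_le.
by rewrite lerNl; apply: n_center_le => //; exact: n_center_opp.
Qed.
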